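(* Let $d\ge 2$, let $S\subset \mathrm{Sl}(d,\mathbb{R})$ be a connected semigroup with nonempty interior in $\mathrm{Sl}(d,\mathbb{R})$, let $\Theta(S)\subset\{1,\ldots,d-1\}$ be its flag type, and let $k\in\{1,\ldots,d-1\}$. If $\{0\}\neq W\subset\bigwedge^k\mathbb{R}^d$ is an $S$-invariant cone, then $k\in\Theta(S)$.
   Context: A cone in a finite-dimensional real vector space $V$ means a closed convex cone $W\subset V$ that is proper ($W\neq V$) and non-trivial ($W\neq\{0\}$). $\mathrm{Sl}(d,\mathbb{R})$ acts linearly on $\bigwedge^k\mathbb{R}^d$ by $g(u_1\wedge\cdots\wedge u_k)=gu_1\wedge\cdots\wedge gu_k$; a set $W$ is $S$-invariant if $gW\subset W$ for all $g\in S$. Flag type. Let $\Theta_M=\{1,\ldots,d-1\}$. For $\Theta=\{r_1<\cdots<r_n\}\subset\Theta_M$ let $\mathbb{F}_\Theta$ be the flag manifold of all flags $(V_1\subset\cdots\subset V_n)$ of subspaces of $\mathbb{R}^d$ with $\dim V_i=r_i$ (for $\Theta=\emptyset$, $\mathbb{F}_\Theta$ is a point), with the natural action of $\mathrm{Sl}(d,\mathbb{R})$; write $\mathbb{F}=\mathbb{F}_{\Theta_M}$ and let $\pi_\Theta:\mathbb{F}\to\mathbb{F}_\Theta$ be the canonical projection. An invariant control set of $S$ in $\mathbb{F}_\Theta$ is a subset $D\subset\mathbb{F}_\Theta$ such that $\mathrm{cl}(Sx)=D$ for all $x\in D$ and $D$ is maximal with this property. It is known that for a semigroup $S$ with nonempty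 interior there is exactly one invariant control set $C_\Theta$ in each $\mathbb{F}_\Theta$ (write $C$ for the one in $\mathbb{F}$), and that among the sets $\Theta\subset\Theta_M$ with $\pi_\Theta^{-1}(C_\Theta)=C$ there is exactly one minimal one; it is denoted $\Theta(S)$ and called the flag type of $S$. *)

(* Defs.v *)
From HB Require Import structures.
From mathcomp Require Import all_boot all_order all_algebra perm.
From mathcomp Require Import all_classical all_reals all_analysis.

Set Implicit Arguments.
Unset Strict Implicit.
Unset Printing Implicit Defensive.

Import Order.TTheory GRing.Theory Num.Theory.
Import numFieldNormedType.Exports.

Local Open Scope classical_set_scope.
Local Open Scope ring_scope.

(* Used through the coercion set_type: its topology is the one induced by
   'M[R]_d. *)
Definition SL (R : realType) (d : nat) : set 'M[R]_d := [set g | \det g = 1].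
Arguments SL : clear implicits.

Section SpecialLinear.
Context {R : realType} {d : nat}.

Lemma SL_det (g : SL R d) : \det (val g) = 1.
Proof. exact: (set_mem (valP g)). Qed.

Lemma SL_unit (g : SL R d) : val g \in unitmx.
Proof. by rewrite unitmxE SL_det unitr1. Qed.

Fact SL_mul_proof (g h : SL R d) : val g *m val h \in SL R d.
Proof. by apply: mem_set; rewrite /SL /= det_mulmx !SL_det mulr1. Qed.

Definition SL_mul (g h : SL R d) : SL R d :=
  exist _ (val g *m val h) (SL_mul_proof g h).

Definition semigroup (S : set (SL R d)) : Prop :=
  forall g h, S g -> S h -> S (SL_mul g h).

End SpecialLinear.

Definition ThetaM (d : nat) : set nat := [set r | (0 < r < d)%N].

(* A flag of type {r_1 < ... < r_n} is indexed by the dimensions themselves: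
   r_i is sent to V_i. *)
Record flag (R : realType) (d : nat) (Theta : set nat) := Flag {
  flag_space :> Theta -> {vspace 'cV[R]_d};
  flag_dim : forall r : Theta, \dim (flag_space r) = val r;
  flag_incl : forall r s : Theta, (val r <= val s)%N ->
    (flag_space r <= flag_space s)%VS
}.

HB.instance Definition _ (R : realType) (d : nat) (Theta : set nat) :=
  gen_eqMixin (flag R d Theta).
HB.instance Definition _ (R : realType) (d : nat) (Theta : set nat) :=
  gen_choiceMixin (flag R d Theta).

Section FlagManifold.
Context {R : realType} {d : nat} {Theta : set nat}.

Fact flag_act_dim (g : SL R d) (V : flag R d Theta) (r : Theta) :
  \dim (linfun (mulmx (val g)) @: V r)%VS = val r.
Proof.
rewrite limg_dim_eq ?flag_dim //; apply/eqP.
suff -> : lker (linfun (mulmx (val g) : 'cV_d -> 'cV_d)) = 0%VS by rewrite capv0.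
apply/eqP/lker0P => x y; rewrite !lfunE /=.
by apply: (can_inj (mulKmx (SL_unit g))).
Qed.

Fact flag_act_incl (g : SL R d) (V : flag R d Theta) (r s : Theta) :
  (val r <= val s)%N ->
  (linfun (mulmx (val g)) @: V r <= linfun (mulmx (val g)) @: V s)%VS.
Proof. by move=> rs; apply: limgS; exact: flag_incl. Qed.

Definition flag_act (g : SL R d) (V : flag R d Theta) : flag R d Theta :=
  Flag (flag_act_dim g V) (@flag_act_incl g V).

(* The topology of the flag manifold as a homogeneous space Sl(d,R) / P: the
   finest one for which all orbit maps g |-> g V are continuous.  Since the
   action is transitive, a single orbit map would define the same topology. *)
Definition flag_open (U : set (flag R d Theta)) : Prop :=
  forall V, open [set g : SL R d | U (flag_act g V)].

Fact flag_openT : flag_open setT.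
Proof. by move=> V; exact: openT. Qed.

Fact flag_openI : setI_closed flag_open.
Proof. by move=> A B oA oB V; exact: (openI (oA V) (oB V)). Qed.

Fact flag_open_bigcup (I : Type) (f : I -> set (flag R d Theta)) :
  (forall i, flag_open (f i)) -> flag_open (\bigcup_i f i).
Proof. by move=> fo V; exact: (bigcup_open (fun i _ => fo i V)). Qed.

HB.instance Definition _ := isOpenTopological.Build (flag R d Theta)
  flag_openT flag_openI flag_open_bigcup.

(* The empty set satisfies P; maximality rules it out as soon as some nonempty
   set satisfies P. *)
Definition invariant_control_set (S : set (SL R d)) (D : set (flag R d Theta)) :
    Prop :=
  let P (E : set (flag R d Theta)) :=
    forall V, E V -> closure [set flag_act g V | g in S] = E in
  P D /\ (forall E, P E -> D `<=` E -> E = D).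

End FlagManifold.

Definition index_incl (Theta Theta' : set nat) (sub : Theta `<=` Theta')
    (r : Theta) : Theta' :=
  exist _ (val r) (mem_set (sub _ (set_mem (valP r)))).

Definition flag_proj (R : realType) (d : nat) (Theta Theta' : set nat)
    (sub : Theta `<=` Theta') (V : flag R d Theta') : flag R d Theta :=
  @Flag R d Theta (fun r => V (index_incl sub r))
    (fun r => flag_dim V (index_incl sub r))
    (fun r s => @flag_incl _ _ _ V (index_incl sub r) (index_incl sub s)).

Definition determines_control_set (R : realType) (d : nat)
    (S : set (SL R d)) (Theta : set nat) : Prop :=
  exists (sub : Theta `<=` ThetaM d)
         (C : set (flag R d (ThetaM d))) (CTheta : set (flag R d Theta)),
    [/\ invariant_control_set S C, invariant_control_set S CTheta &
        flag_proj sub @^-1` CTheta = C].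

Definition is_flag_type (R : realType) (d : nat)
    (S : set (SL R d)) (Theta : set nat) : Prop :=
  determines_control_set S Theta /\
  forall Theta', determines_control_set S Theta' -> Theta' `<=` Theta ->
    Theta' = Theta.

(* Strictly increasing maps, which index the basis
   e_(f 0) /\ ... /\ e_(f (k - 1)) of the k-th exterior power of R^d. *)
Definition incr_map (k d : nat) : Type :=
  {f : {ffun 'I_k -> 'I_d} |
    [forall i : 'I_k, forall j : 'I_k, (i < j)%N ==> (f i < f j)%N]}.

Notation ext R k d := ('cV[R]_#|{: incr_map k d}|).

Section ExteriorPower.
Context {R : realType} {k d : nat}.
Implicit Type f : incr_map k d.

(* u_1 /\ ... /\ u_k, where u_1, ..., u_k are the columns of U: its coordinates
   are the k x k minors of U. *)
Definition wedge (U : 'M[R]_(d, k)) : ext R k d :=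
  \col_(a < #|{: incr_map k d}|) \det (rowsub (val (enum_val a) : 'I_k -> 'I_d) U).

(* The linear extension of
   e_(f 0) /\ ... /\ e_(f (k - 1)) |-> g e_(f 0) /\ ... /\ g e_(f (k - 1)). *)
Definition ext_act (g : 'M[R]_d) (w : ext R k d) : ext R k d :=
  \sum_(a < #|{: incr_map k d}|) w a 0 *: wedge (colsub (val (enum_val a) : 'I_k -> 'I_d) g).

Lemma incr_mapP f (i j : 'I_k) : (i < j)%N -> (val f i < val f j)%N.
Proof. by have /forallP/(_ i)/forallP/(_ j)/implyP := valP f. Qed.

Lemma incr_map_inj f : injective (val f).
Proof.
move=> i j; have [ij|ji|/val_inj//] := ltngtP i j => eq_f.
- by have := incr_mapP f ij; rewrite eq_f ltnn.
- by have := incr_mapP f ji; rewrite eq_f ltnn.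
Qed.

Lemma incr_map_sorted f :
  sorted (fun i j : 'I_d => (i < j)%N) [seq val f i | i <- enum 'I_k].
Proof.
rewrite sorted_map; apply: (@sub_sorted _ (fun i j : 'I_k => (i < j)%N)).
  by move=> i j; exact: incr_mapP.
by have := iota_ltn_sorted 0 k; rewrite -val_enum_ord sorted_map.
Qed.

Lemma incr_map_eq f f' :
  (forall i, exists j, val f i = val f' j) -> f = f'.
Proof.
move=> ff'; pose s f := [seq val f i | i <- enum 'I_k].
have s_uniq h : uniq (s h) by rewrite map_inj_uniq ?enum_uniq//; exact: incr_map_inj.
have sub : {subset s f <= s f'}.
  move=> _ /mapP[i _ ->]; have [j ->] := ff' i.
  by apply/mapP; exists j; rewrite ?mem_enum.
have [_ eq_s] := uniq_min_size (s_uniq f) sub (eq_leq (etrans (size_map _ _) (esym (size_map _ _)))).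
have : s f = s f'.
  apply: (irr_sorted_eq _ _ (incr_map_sorted f) (incr_map_sorted f')) => //.
  - by move=> y x z; exact: ltn_trans.
  - by move=> x; rewrite ltnn.
move=> eq_sf; apply: val_inj; apply/ffunP => i.
have nthE h : nth (val f i) (s h) i = val h i.
  by rewrite (nth_map i) ?size_enum_ord// nth_ord_enum.
by rewrite -(nthE f) eq_sf nthE.
Qed.

Lemma incr_map_factor (phi : {ffun 'I_k -> 'I_d}) : injective phi ->
  exists f (s : 'S_k), phi = [ffun i => val f (s i)].
Proof.
move=> phi_inj; pose lt (i j : 'I_d) := (i < j)%N; pose le (i j : 'I_d) := (i <= j)%N.
pose t := [tuple phi i | i < k].
pose u := [tuple of sort le t].
have u_uniq : uniq u.
  by rewrite sort_uniq map_inj_uniq ?enum_uniq.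
have u_sorted : sorted lt u.
  have := sort_sorted (fun i j : 'I_d => leq_total i j) t.
  move: u_uniq; rewrite /= -/le; move: (sort le _) => v.
  rewrite -(map_inj_uniq val_inj) => uv sv.
  have : sorted ltn (map val v) by rewrite ltn_sorted_uniq_leq uv sorted_map.
  by rewrite sorted_map.
have /tuple_permP[s tE] : perm_eq t u by rewrite perm_sym; exact/permEl/perm_sort.
have f_incr : [forall i : 'I_k, forall j : 'I_k, (i < j)%N ==>
    ([ffun i => tnth u i] i < [ffun i => tnth u i] j)%N].
  apply/forallP => i; apply/forallP => j; apply/implyP => ij; rewrite !ffunE.
  rewrite !(tnth_nth (phi i)).
  apply: (sorted_ltn_nth (leT := lt)) => //.
  - by move=> y x z; exact: ltn_trans.
  - by rewrite inE size_tuple.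
  - by rewrite inE size_tuple.
exists (exist _ [ffun i => tnth u i] f_incr : incr_map k d), s.
apply/ffunP => i; rewrite !ffunE.
by have := congr1 (fun v => tnth v i) (val_inj tE); rewrite !tnth_mktuple.
Qed.

Lemma det_mulmx_incr (A : 'M[R]_(k, d)) (B : 'M[R]_(d, k)) :
  \det (A *m B) = \sum_(f : incr_map k d)
    \det (colsub (val f : 'I_k -> 'I_d) A) *
    \det (rowsub (val f : 'I_k -> 'I_d) B).
Proof.
transitivity (\sum_(phi : {ffun 'I_k -> 'I_d})
    (\prod_i A i (phi i)) * \det (rowsub phi B)).
  transitivity (\sum_(phi : {ffun 'I_k -> 'I_d})
     \sum_(s : 'S_k) (-1) ^+ s * \prod_i (A i (phi i) * B (phi i) (s i))).
    rewrite exchange_big; apply: eq_bigr => /= s _; rewrite -big_distrr /=.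
    congr (_ * _).
    rewrite -(bigA_distr_bigA (fun i j => A i j * B j (s i))) /=.
    by apply: eq_bigr => x _; rewrite mxE.
  apply: eq_bigr => phi _; rewrite big_distrr /=; apply: eq_bigr => s _.
  rewrite big_split mulrCA; congr (_ * (_ * _)).
  by apply: eq_bigr => i _; rewrite mxE.
rewrite (bigID (fun phi : {ffun 'I_k -> 'I_d} => injectiveb phi)) /=.
rewrite addrC big1 ?add0r => [|phi /injectivePn[i1 [i2 ne12 eq12]]]; last first.
  rewrite (determinant_alternate ne12) ?mulr0// => j.
  by rewrite !mxE eq12.
pose h (p : incr_map k d * 'S_k) := [ffun i => val p.1 (p.2 i)].
have h_inj : injective h.
  move=> [f s] [f' s'] /ffunP ff'.
  have eqf : f = f'.
    apply: incr_map_eq => i; exists (s' (s^-1%g i)).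
    by have := ff' (s^-1%g i); rewrite !ffunE /= permKV.
  rewrite -{f'}eqf in ff' *; congr pair; apply/permP => i.
  by have := ff' i; rewrite !ffunE => /incr_map_inj.
rewrite (eq_bigl (fun phi => phi \in [set h p | p in [set: _]]%SET)); last first.
  move=> phi; apply/injectiveP/imsetP => [/incr_map_factor[f [s ->]]|[[f s] _ ->]].
    by exists (f, s).
  by move=> i j; rewrite !ffunE => /incr_map_inj/perm_inj.
rewrite big_imset /=; last by move=> ? ? _ _; exact: h_inj.
rewrite (eq_bigl predT) => [|p]; last by rewrite inE.
rewrite -(pair_bigA _ (fun f s =>
  (\prod_i A i (h (f, s) i)) * \det (rowsub (h (f, s)) B))) /=.
apply: eq_bigr => f _; rewrite big_distrl /=; apply: eq_bigr => s _.
have -> : rowsub (h (f, s)) B = row_perm s (rowsub (val f) B).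
  by apply/matrixP => i j; rewrite !mxE ffunE.
rewrite row_permE det_mulmx det_perm mulrA -[_ * (-1) ^+ s]mulrC.
by congr (_ * _ * _); apply: eq_bigr => i _; rewrite mxE ffunE.
Qed.

Lemma ext_act_wedge (g : 'M[R]_d) (U : 'M[R]_(d, k)) :
  ext_act g (wedge U) = wedge (g *m U).
Proof.
apply/matrixP => b c; rewrite summxE !mxE -mul_rowsub_mx det_mulmx_incr.
rewrite (reindex (enum_val : 'I_#|{: incr_map k d}| -> incr_map k d)) /=; last first.
  exact: (onW_bij _ (enum_val_bij _)).
apply: eq_bigr => a _; rewrite !mxE mulrC; congr (\det _ * _).
by apply/matrixP => i j; rewrite !mxE.
Qed.

Lemma wedge_basis (a : 'I_#|{: incr_map k d}|) :
  wedge (colsub (val (enum_val a) : 'I_k -> 'I_d) 1%:M) = delta_mx a 0.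
Proof.
apply/matrixP => b c; rewrite !mxE ord1 eqxx andbT.
have [->|ne] := eqVneq b a.
  suff -> : rowsub (val (enum_val a) : 'I_k -> 'I_d)
      (colsub (val (enum_val a) : 'I_k -> 'I_d) 1%:M) = 1%:M :> 'M[R]_k.
    by rewrite det1.
  by apply/matrixP => i j; rewrite !mxE (inj_eq (@incr_map_inj _)).
have [i hi] : exists i, forall j, val (enum_val b) i != val (enum_val a) j.
  apply: contrapT => nex; case/eqP: ne; apply: enum_val_inj.
  apply: incr_map_eq => i; apply: contrapT => nj; apply: nex; exists i => j.
  by apply/eqP => eq_ij; apply: nj; exists j.
rewrite (expand_det_row _ i) big1// => j _.
by rewrite !mxE (negPf (hi j)) mul0r.
Qed.

End ExteriorPower.

Definition cone (R : realType) (V : normedModType R) (W : set V) : Prop :=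
  [/\ closed W, W !=set0, convex_set W,
      forall a x, 0 <= a -> W x -> W (a *: x) &
      W <> setT /\ W <> [set 0]].

(* Main.v *)
(* Let T be the set of positive multiples of elements of S, with nonempty interior
   in the space of all matrices.  By the real Schur form, a matrix in the interior
   of T can be perturbed, making the arguments of its complex eigenvalues rational
   multiples of pi, so that some power has only positive eigenvalues; perturbing
   once more, T contains h = Q diag(l) Q^-1 with l_0 > l_1 > ... > 0.  Let x be the
   flag spanned by the columns of Q.  An element of T moves any given flag into
   general position (LU factorisation), and the powers of h then carry it to x.
   Hence x lies in the closure of every S-orbit, and C = cl(Sx).

   The same argument in the exterior power puts u_x = Q e_0 /\ ... /\ Q e_(k-1) in
   W or -W.  As the condition "the line of V_k lies in W or -W" is closed and
   S-invariant, it holds for all flags V in C.  Moreover W is pointed: the subspace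
   of vectors w with both w and -w in W is S-invariant, hence trivial because S has
   interior and the exterior power is irreducible.

   If k were not in Theta, C would contain all flags that differ from x in V_k only,
   so W or -W would contain p + t q for every real t, where p = u_x and q is p with
   its last factor replaced by Q e_k.  By connectedness of the real line one of the
   two cones contains all of them; dividing by |t| and letting t tend to +oo and
   -oo, it contains q and -q, against pointedness. *)

Require Import Defs.
From mathcomp Require Import all_boot all_order all_algebra.
From mathcomp Require Import perm.
From mathcomp Require Import all_classical all_reals all_analysis.
From mathcomp Require Import complex.
From mathcomp Require Import ring lra.

Set Implicit Arguments.
Unset Strict Implicit.
Unset Printing Implicit Defensive.

Import Order.TTheory GRing.Theory Num.Theory.
Import numFieldNormedType.Exports.

Local Open Scope classical_set_scope.
Local Open Scope ring_scope.

(** * Real functions that agree with a polynomial *)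

Section PolynomialFunctions.
Context {R : realType}.
Implicit Types f g : R -> R.

(** Membership is only existential, so that determinants and matrix products depending on a
    parameter can be handled pointwise, without matrices over [{poly R}]. *)
Definition polyfun f := exists p : {poly R}, forall t, f t = p.[t].

Lemma polyfun_line (a b : R) : polyfun (fun t => a + t * b).
Proof. by exists (a%:P + 'X * b%:P) => t; rewrite !hornerE. Qed.

Lemma polyfun_cst (a : R) : polyfun (fun=> a).
Proof. by exists a%:P => t; rewrite hornerC. Qed.

Lemma polyfunM f g : polyfun f -> polyfun g -> polyfun (fun t => f t * g t).
Proof. by move=> [p fp] [q gq]; exists (p * q) => t; rewrite hornerM fp gq. Qed.

Lemma polyfunD f g : polyfun f -> polyfun g -> polyfun (fun t => f t + g t).
Proof. by move=> [p fp] [q gq]; exists (p + q) => t; rewrite hornerD fp gq. Qed.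

Lemma polyfun_sum (I : Type) (r : seq I) (P : pred I) (F : I -> R -> R) :
  (forall i, polyfun (F i)) -> polyfun (fun t => \sum_(i <- r | P i) F i t).
Proof.
move=> Fp; elim: r => [|i r [p IH]].
  by exists 0 => t; rewrite big_nil horner0.
have [q Fq] := Fp i; exists (if P i then q + p else p) => t.
by rewrite big_cons; case: ifP => _; rewrite ?hornerD IH ?Fq.
Qed.

Lemma polyfun_prod (I : Type) (r : seq I) (P : pred I) (F : I -> R -> R) :
  (forall i, polyfun (F i)) -> polyfun (fun t => \prod_(i <- r | P i) F i t).
Proof.
move=> Fp; elim: r => [|i r [p IH]].
  by exists 1 => t; rewrite big_nil hornerC.
have [q Fq] := Fp i; exists (if P i then q * p else p) => t.
by rewrite big_cons; case: ifP => _; rewrite ?hornerM IH ?Fq.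
Qed.

Lemma polyfun_det n (A : R -> 'M[R]_n) :
  (forall i j, polyfun (fun t => A t i j)) -> polyfun (fun t => \det (A t)).
Proof.
move=> Ap; apply: polyfun_sum => s; apply: polyfunM; first exact: polyfun_cst.
exact: polyfun_prod.
Qed.

Lemma polyfun_mulmx m n p q (P : 'M[R]_(m, n)) (A : R -> 'M[R]_(n, p))
    (Q : 'M[R]_(p, q)) :
  (forall i j, polyfun (fun t => A t i j)) ->
  forall i j, polyfun (fun t => (P *m A t *m Q) i j).
Proof.
move=> Ap i j; under eq_fun do rewrite mxE.
apply: polyfun_sum => k; apply: polyfunM; last exact: polyfun_cst.
under eq_fun do rewrite mxE.
by apply: polyfun_sum => l; apply: polyfunM; first exact: polyfun_cst.
Qed.

(** The source of every generic perturbation below: a condition that holds at the far point [t = 1]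
    already holds at arbitrarily small [t], since a nonzero polynomial has finitely many roots. *)
Lemma polyfun_small_neq0 f (e : R) : polyfun f -> f 1 != 0 -> 0 < e ->
  exists2 t, 0 < t < e & f t != 0.
Proof.
move=> [p fp] f1 e0; apply: contrapT => nex.
have p0 : p != 0 by apply: contraNneq f1 => p0; rewrite fp p0 horner0.
(* These are [size p] distinct points, one root too many for [p]; the shift [i.+2] keeps them
   strictly below [e]. *)
pose rs := [seq e / (i.+2)%:R | i <- iota 0 (size p)].
suff : (size rs < size p)%N by rewrite size_map size_iota ltnn.
apply: max_poly_roots => //.
  apply/allP => _ /mapP[i _ ->]; apply/rootP; apply/eqP; apply: contrapT => /negP.
  rewrite -fp => ft; apply: nex; exists (e / i.+2%:R) => //.
  by rewrite divr_gt0 ?ltr0n// ltr_pdivrMr ?ltr0n// ltr_pMr// ltr1n.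
rewrite map_inj_uniq ?iota_uniq// => i j /(mulfI (lt0r_neq0 e0)) /invr_inj.
by move=> /eqP; rewrite eqr_nat => /eqP[].
Qed.

End PolynomialFunctions.

(** * Regular elements of open semigroups of matrices *)

Section Perturbation.
Context {R : realType}.

Definition mxclose m n (e : R) (A B : 'M[R]_(m, n)) :=
  forall i j, `|A i j - B i j| < e.

Lemma mxclose_mull m n p (P : 'M[R]_(m, n)) (e : R) : 0 < e ->
  exists2 d, 0 < d & forall X Y : 'M[R]_(n, p),
    mxclose d X Y -> mxclose e (P *m X) (P *m Y).
Proof.
(* The summand [1] makes [K] positive and strictly larger than each absolute row sum of [P]. *)
move=> e0; pose K := 1 + \sum_i \sum_j `|P i j|.
have sP i : \sum_j `|P i j| < K.
  rewrite /K (bigD1 i)//= addrCA ltrDl ltr_wpDr//.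
  by apply: sumr_ge0 => *; apply: sumr_ge0.
have K0 : 0 < K by rewrite ltr_wpDr//; apply: sumr_ge0 => *; apply: sumr_ge0.
exists (e / K) => [|X Y XY i j]; first exact: divr_gt0.
rewrite !mxE -sumrB; apply: (@le_lt_trans _ _ (\sum_k `|P i k| * (e / K))).
  apply: le_trans (ler_norm_sum _ _ _) _; apply: ler_sum => k _.
  by rewrite -mulrBr normrM ler_wpM2l// ltW.
rewrite -mulr_suml mulrC mulrAC -mulrA gtr_pMr// ltr_pdivrMr// mul1r.
exact: sP.
Qed.

Lemma mxclose_mul m n p q (P : 'M[R]_(m, n)) (Q : 'M[R]_(p, q)) (e : R) :
  0 < e -> exists2 d, 0 < d & forall X Y,
    mxclose d X Y -> mxclose e (P *m X *m Q) (P *m Y *m Q).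
Proof.
move=> e0; have [d1 d10 h1] := @mxclose_mull _ _ m Q^T _ e0.
have [d d0 h] := @mxclose_mull _ _ p P _ d10.
exists d => // X Y XY i j.
have := h1 (P *m X)^T (P *m Y)^T _ j i; rewrite -!trmx_mul !mxE; apply=> k l.
by rewrite !mxE; have := h _ _ XY l k; rewrite !mxE.
Qed.

(** [is_trig_mx] means lower triangular. Such matrices form a semigroup, and their eigenvalues, the
    diagonal entries, are positive. *)
Definition trigpos n (A : 'M[R]_n) := is_trig_mx A /\ forall i, 0 < A i i.

Lemma is_trig_mulmx n (A B : 'M[R]_n) :
  is_trig_mx A -> is_trig_mx B -> is_trig_mx (A *m B).
Proof.
move=> /is_trig_mxP A0 /is_trig_mxP B0; apply/is_trig_mxP => i j ij.
rewrite mxE big1// => k _; have [ik|ki] := ltnP i k.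
  by rewrite A0 ?mul0r.
by rewrite B0 ?mulr0//; exact: leq_ltn_trans ki ij.
Qed.

Lemma is_trig_mulmx_diag n (A B : 'M[R]_n) i :
  is_trig_mx A -> is_trig_mx B -> (A *m B) i i = A i i * B i i.
Proof.
move=> /is_trig_mxP A0 /is_trig_mxP B0.
rewrite mxE (bigD1 i)//= big1 ?addr0// => k; rewrite neq_ltn => /orP[ki|ik].
  by rewrite B0 ?mulr0.
by rewrite A0 ?mul0r.
Qed.

Lemma trigposM n (A B : 'M[R]_n) : trigpos A -> trigpos B -> trigpos (A *m B).
Proof.
move=> [At A0] [Bt B0]; split; first exact: is_trig_mulmx.
by move=> i; rewrite is_trig_mulmx_diag// mulr_gt0.
Qed.

Lemma trigpos1 n : trigpos (1%:M : 'M[R]_n).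
Proof. by split=> // i; rewrite mxE eqxx. Qed.

Lemma trigposX n (A : 'M[R]_n) k : trigpos A -> trigpos (A ^+ k).
Proof.
by move=> A0; elim: k => [|k IH]; [exact: trigpos1|rewrite exprS; apply: trigposM].
Qed.

Lemma trigpos_block m n (A : 'M[R]_m) (C : 'M[R]_(n, m)) (D : 'M[R]_n) :
  trigpos A -> trigpos D -> trigpos (block_mx A 0 C D : 'M[R]_(m + n)).
Proof.
move=> [At A0] [Dt D0]; split; first by rewrite is_trig_block_mx// eqxx At.
by move=> i; case: (split_ordP i) => j ->; rewrite ?block_mxEul ?block_mxEdr.
Qed.
End Perturbation.

(** * Plane rotations and rational angles *)

Section Rotations.
Context {R : realType}.

Definition rotmx (t : R) : 'M[R]_(1 + 1) :=
  block_mx (cos t)%:M (- sin t)%:M (sin t)%:M (cos t)%:M.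

Lemma rotmxD s t : rotmx s *m rotmx t = rotmx (s + t).
Proof.
rewrite /rotmx mulmx_block -!scalar_mxM -!raddfD cosD sinD /=.
by congr block_mx; congr (_%:M); ring.
Qed.

Lemma rotmx_period k : rotmx ((pi *+ 2) *+ k) = 1%:M.
Proof.
rewrite /rotmx -[_ *+ k]add0r !(periodicn (@cosD2pi R)) !(periodicn (@sinD2pi R)).
by rewrite cos0 sin0 oppr0 raddf0 -scalar_mx_block.
Qed.

Lemma exprZ_rotmx (r t : R) k : (r *: rotmx t) ^+ k = r ^+ k *: rotmx (t *+ k).
Proof.
elim: k => [|k IH]; first by rewrite !expr0 scale1r (rotmx_period 0).
rewrite exprS IH [_ * _](_ : _ = (r *: rotmx t) *m (r ^+ k *: rotmx (t *+ k)))//.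
by rewrite -scalemxAl -scalemxAr scalerA rotmxD mulrS exprS.
Qed.

(** [acos] covers the upper half circle; on the lower half its opposite is shifted by a full turn,
    to keep the angle nonnegative for the truncation in [rotmx_rational_dense]. *)
Lemma exists_angle (c s : R) : c ^+ 2 + s ^+ 2 = 1 ->
  exists t, [/\ 0 <= t, cos t = c & sin t = s].
Proof.
move=> cs; have c1 : -1 <= c <= 1.
  by rewrite -ler_norml -sqrtr_sqr -sqrtr1 ler_wsqrtr// -cs lerDl sqr_ge0.
have [/andP[t0 tpi] ct] := acos_def c1; have st := sin_acos c1.
have {}st : sin (acos c) = `|s|.
  by rewrite st -sqrtr_sqr; congr Num.sqrt; rewrite -cs; ring.
have [s0|s0] := leP 0 s.
  by exists (acos c); split => //; rewrite st ger0_norm.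
exists (- acos c + pi *+ 2); split.
- by rewrite addrC subr_ge0 (le_trans tpi)// mulr2n lerDl pi_ge0.
- by rewrite cosD2pi cosN.
- by rewrite sinD2pi sinN st ltr0_norm ?opprK.
Qed.

(** The multiples of a small angle [w], an integral fraction of the full turn, come close to [t]:
    the one used is [j * w] with [j] the integral part of [t / w]. *)
Lemma rotmx_rational_dense (r t e : R) : 0 <= t -> 0 < e ->
  exists s k, [/\ (0 < k)%N, mxclose e (r *: rotmx s) (r *: rotmx t) &
    rotmx (s *+ k) = 1%:M].
Proof.
move=> t0 e0.
have tp0 : 0 < pi *+ 2 :> R by rewrite mulrn_wgt0 ?pi_gt0.
have : \forall s \near t, `|r * cos s - r * cos t| < e /\ `|r * sin s - r * sin t| < e.
  have hc : (fun s => r * cos s) @ t --> r * cos t.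
    by apply: cvgM; [exact: cvg_cst|exact: continuous_cos].
  have hs : (fun s => r * sin s) @ t --> r * sin t.
    by apply: cvgM; [exact: cvg_cst|exact: continuous_sin].
  move/cvgrPdist_lt : hc => /(_ _ e0) hc; move/cvgrPdist_lt : hs => /(_ _ e0) hs.
  by near=> s; split; rewrite distrC; near: s.
move=> /nbhs_ballP[d /= d0 hd].
have [k kd] : exists k : nat, pi *+ 2 / k.+1%:R < d.
  exists (Num.trunc (pi *+ 2 / d)); rewrite ltr_pdivrMr ?ltr0n// mulrC.
  have /andP[_] := truncn_itv (divr_ge0 (ltW tp0) (ltW d0)).
  by rewrite ltr_pdivrMr.
pose w : R := pi *+ 2 / k.+1%:R.
have w0 : 0 < w by rewrite divr_gt0 ?ltr0n.
have := truncn_itv (divr_ge0 t0 (ltW w0)); set j := Num.trunc _ => /andP[jl ju].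
rewrite ler_pdivlMr// in jl; rewrite ltr_pdivrMr// in ju.
exists (j%:R * w), k.+1; split => //; last first.
  rewrite (_ : _ *+ _ = (pi *+ 2) *+ j) ?rotmx_period//.
  by rewrite -[LHS]mulr_natr -mulrA /w divfK ?pnatr_eq0// mulr_natl.
have /hd[hc hs] : ball t d (j%:R * w).
  rewrite /ball/= ger0_norm ?subr_ge0// ltrBlDr (lt_le_trans ju)//.
  by rewrite -natr1 mulrDl mul1r addrC lerD2r ltW.
move=> i1 j1; rewrite !mxE.
case: (splitP i1) => i2 _; rewrite !mxE; case: (splitP j1) => j2 _;
  by rewrite !mxE !ord1 /= !mulr1n ?mulrN -?opprD ?normrN.
Unshelve. all: by end_near.
Qed.

End Rotations.

(** * Nearby matrices with a power similar to a positive triangular one *)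

Section TriangularPowers.
Context {R : realType}.

(** Take a complex eigenvalue [a + i b] with a left eigenvector [x + i y]. If [b = 0], then [x] or
    [y] is a real eigenvector; otherwise the two span an invariant plane. *)
Lemma real_eigenline_or_plane n (g : 'M[R]_n) : (0 < n)%N ->
  (exists a (v : 'rV_n), v != 0 /\ v *m g = a *: v) \/
  (exists a b (x y : 'rV_n), [/\ b != 0, row_free (col_mx x y),
     x *m g = a *: x - b *: y & y *m g = b *: x + a *: y]).
Proof.
move=> n0; have [l /eigenvalueP[v vg v0]] :=
  complex.Theorem7' (map_mx (complex.real_complex R) g) n0.
pose Re := @complex.Re R; pose Im := @complex.Im R.
pose a := Re l; pose b := Im l.
pose x : 'rV[R]_n := map_mx Re v; pose y : 'rV[R]_n := map_mx Im v.
have ReS (F : 'I_n -> complex.complex R) : Re (\sum_j F j) = \sum_j Re (F j).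
  by apply: (big_morph Re) => // -[? ?] [? ?].
have ImS (F : 'I_n -> complex.complex R) : Im (\sum_j F j) = \sum_j Im (F j).
  by apply: (big_morph Im) => // -[? ?] [? ?].
have xg : x *m g = a *: x - b *: y.
  apply/rowP => j; have /rowP/(_ j)/(congr1 Re) := vg; rewrite !mxE ReS.
  rewrite (eq_bigr (fun k => x 0 k * g k j)) => [->|k _].
    by rewrite /a /b; case: l {vg a b} => ? ?; case: (v 0 j).
  by rewrite !mxE /Re; case: (v 0 k) => ? ?; rewrite /= mulr0 subr0.
have yg : y *m g = b *: x + a *: y.
  apply/rowP => j; have /rowP/(_ j)/(congr1 Im) := vg; rewrite !mxE ImS.
  rewrite (eq_bigr (fun k => y 0 k * g k j)) => [->|k _].
    by rewrite /a /b; case: l {vg a b xg} => ? ?; case: (v 0 j) => ? ? /=; ring.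
  by rewrite !mxE /Im; case: (v 0 k) => ? ?; rewrite /= mulr0 add0r mulrC.
have xy0 : ~ (x = 0 /\ y = 0).
  move=> [x0 y0]; case/eqP: v0; apply/rowP => j.
  have /rowP/(_ j) := x0; have /rowP/(_ j) := y0; rewrite !mxE /Re /Im.
  by case: (v 0 j) => ? ? /= -> ->.
have [b0|b0] := eqVneq b 0.
  left; move: xg yg; rewrite b0 !scale0r subr0 add0r => xg yg.
  have [x0|x0] := eqVneq x 0; last by exists a, x.
  by exists a, y; split => //; apply/eqP => y0; apply: xy0.
right; exists a, b, x, y; split => //.
apply: inj_row_free => u; rewrite -[u]hsubmxK mul_row_col.
rewrite [lsubmx u]mx11_scalar [rsubmx u]mx11_scalar !mul_scalar_mx.
move: (lsubmx u 0 0) (rsubmx u 0 0) => c e ce0.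
(* Multiplying the relation [c x + e y = 0] by [g] and subtracting [a] times it leaves
   [b (e x - c y) = 0]. *)
have ce1 : e *: x - c *: y = 0.
  have : (c *: x + e *: y) *m g = 0 by rewrite ce0 mul0mx.
  rewrite mulmxDl -!scalemxAl xg yg => h.
  have : b *: (e *: x - c *: y) = 0.
    rewrite -h -[RHS]subr0 -[X in _ = _ - X](scaler0 _ a) -ce0.
    by apply/rowP => j; rewrite !mxE; ring.
  by move/eqP; rewrite scaler_eq0 (negPf b0) => /eqP.
(* The two relations are solved for [x] and [y]; the determinant of the system is
   [c ^+ 2 + e ^+ 2]. *)
have hx : (c ^+ 2 + e ^+ 2) *: x = 0.
  rewrite -(scaler0 _ c) -[RHS]addr0 -[X in _ = _ + X](scaler0 _ e) -{1}ce0 -ce1.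
  by apply/rowP => j; rewrite !mxE; ring.
have hy : (c ^+ 2 + e ^+ 2) *: y = 0.
  rewrite -(scaler0 _ e) -[RHS]subr0 -[X in _ = _ - X](scaler0 _ c) -{1}ce0 -ce1.
  by apply/rowP => j; rewrite !mxE; ring.
have : c ^+ 2 + e ^+ 2 == 0.
  apply/negPn/negP => s0; apply: xy0; move/eqP: hx; move/eqP: hy.
  by rewrite !scaler_eq0 (negPf s0) /= => /eqP -> /eqP.
rewrite paddr_eq0 ?sqr_ge0// !sqrf_eq0 => /andP[/eqP-> /eqP->].
by rewrite !raddf0 row_mx0.
Qed.

Definition trig_dense n (g : 'M[R]_n) := forall e, 0 < e ->
  exists (g' : 'M[R]_n) k Q, [/\ mxclose e g' g, (0 < k)%N, Q \in unitmx &
    trigpos (Q *m g' ^+ k *m invmx Q)].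

Lemma block_lower_exp m n (A : 'M[R]_m) (C : 'M[R]_(n, m)) (D : 'M[R]_n) k :
  exists C', (block_mx A 0 C D : 'M[R]_(m + n)) ^+ k = block_mx (A ^+ k) 0 C' (D ^+ k).
Proof.
elim: k => [|k [C' IH]].
  by exists 0; rewrite !expr0 [1](scalar_mx_block m n).
exists (C *m A ^+ k + D *m C'); rewrite exprS IH.
rewrite [LHS](mulmx_block A 0 C D) mul0mx !mulmx0 mul0mx addr0 !add0r.
by rewrite !exprS.
Qed.

Lemma invmx_right n (P P' : 'M[R]_n) : P *m P' = 1%:M -> invmx P = P'.
Proof.
move=> PP'; have [Pu _] := mulmx1_unit PP'.
by rewrite -[LHS]mulmx1 -PP' mulKmx.
Qed.

Lemma invmxM n (P Q : 'M[R]_n) : P \in unitmx -> Q \in unitmx ->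
  invmx (P *m Q) = invmx Q *m invmx P.
Proof.
by move=> Pu Qu; apply: invmx_right; rewrite !mulmxA mulmxK// mulmxV.
Qed.

Lemma conjmx_exp n (Q A : 'M[R]_n) k : Q \in unitmx ->
  (Q *m A *m invmx Q) ^+ k = Q *m A ^+ k *m invmx Q.
Proof.
move=> Qu; elim: k => [|k IH].
  by rewrite !expr0 [Q *m _]mulmx1 mulmxV.
rewrite !exprS IH; rewrite [LHS](_ : _ = Q *m A *m invmx Q *m (Q *m A ^+ k *m invmx Q))//.
by rewrite !mulmxA mulmxKV.
Qed.

(* Block triangularisation along an invariant subspace (the row space of [B])
   reduces [trig_dense] to the two diagonal blocks. *)
Lemma trig_dense_block m n (g : 'M[R]_(m + n)) (B : 'M[R]_(m, m + n)) A :
  row_free B -> B *m g = A *m B ->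
  (forall e, 0 < e -> exists A' k,
     [/\ mxclose e A' A, (0 < k)%N & trigpos (A' ^+ k)]) ->
  (forall D : 'M[R]_n, trig_dense D) -> trig_dense g.
Proof.
move=> Bfree Bg Ad Dd e e0.
(* The rows of [B] are completed to a basis by means of its rank factorisation. *)
have [Q Qu uQ] : exists2 Q : 'M[R]_(m + n), Q \in unitmx & usubmx Q = B.
  pose E := row_ebase B; pose K := col_ebase B.
  have BE : B = K *m usubmx E.
    have := mulmx_ebase B; rewrite (eqP Bfree) pid_mx_row -/E -/K => {1}<-.
    by rewrite -{1}[E]vsubmxK -mulmxA mul_row_col mul1mx mul0mx addr0.
  exists (block_mx K 0 0 1%:M *m E).
    rewrite unitmx_mul row_ebase_unit andbT unitmxE det_ublock det1 mulr1.
    by rewrite -unitmxE col_ebase_unit.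
  by rewrite [RHS]BE -{1}[E]vsubmxK mul_block_col mul0mx addr0 col_mxKu.
have [C [D gE]] : exists C D, g = invmx Q *m block_mx A 0 C D *m Q.
  pose G := Q *m g *m invmx Q; exists (dlsubmx G), (drsubmx G).
  have uG : usubmx G = row_mx A 0.
    rewrite /G -!mulmxA -mul_usub_mx uQ mulmxA Bg -mulmxA -uQ mul_usub_mx mulmxV//.
    by rewrite [1%:M](scalar_mx_block m n) block_mxEv col_mxKu mul_mx_row mulmx1 mulmx0.
  have <- : G = block_mx A 0 (dlsubmx G) (drsubmx G).
    by rewrite -{1}[G]vsubmxK uG -{1}[dsubmx G]hsubmxK.
  by rewrite /G !mulmxA mulVmx// mul1mx mulmxKV.
have [d d0 hd] := mxclose_mul (invmx Q) Q e0.
have [A' [k [A'A k0 A't]]] := Ad d d0.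
have [D' [l [P [D'D l0 Pu D't]]]] := Dd D d d0.
pose G' : 'M[R]_(m + n) := block_mx A' 0 C D'.
pose P' : 'M[R]_(m + n) := block_mx 1%:M 0 0 P.
have P'u : P' \in unitmx by rewrite unitmxE det_ublock det1 mul1r -unitmxE.
have P'V : invmx P' = block_mx 1%:M 0 0 (invmx P).
  apply: invmx_right.
  by rewrite mulmx_block !mulmx1 !mulmx0 !mul0mx !addr0 add0r mulmxV// -scalar_mx_block.
(* The exponents [k] and [l] of the two blocks are reconciled in [k * l]. Since the upper block
   needs no conjugation, [P'] is the identity there. *)
have hA : trigpos (A' ^+ (k * l)) by rewrite exprM; apply: trigposX.
have hD : trigpos (P *m D' ^+ (k * l) *m invmx P).
  by rewrite mulnC -conjmx_exp// exprM conjmx_exp//; exact: trigposX.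
exists (invmx Q *m G' *m Q), (k * l)%N, (P' *m Q); split.
- rewrite [X in mxclose _ _ X]gE; apply: hd => i j; rewrite /G'.
  case: (split_ordP i) => i' ->; case: (split_ordP j) => j' ->;
    rewrite ?block_mxEul ?block_mxEur ?block_mxEdl ?block_mxEdr ?subrr ?normr0//.
- by rewrite muln_gt0 k0.
- by rewrite unitmx_mul P'u.
- have -> : (invmx Q *m G' *m Q) ^+ (k * l) = invmx Q *m G' ^+ (k * l) *m Q.
    have := conjmx_exp G' (k * l) (_ : invmx Q \in unitmx).
    by rewrite invmxK; apply; rewrite unitmx_inv.
  rewrite invmxM// !mulmxA mulmxK// mulmxK//.
  have [C' ->] := block_lower_exp A' C D' (k * l).
  rewrite P'V /P' !mulmx_block !(mulmx1, mul1mx, mulmx0, mul0mx, addr0, add0r).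
  exact: trigpos_block hA hD.
Qed.

(** Induction on the size: an invariant line or plane is split off, and the induction hypothesis
    applies to the remaining diagonal block. *)
Lemma trig_dense_all n (g : 'M[R]_n) : trig_dense g.
Proof.
have [m] := ubnP n; elim: m n g => // m IH [|n] g nm.
  move=> e e0; exists g, 1%N, 1%:M; split => //; first by case.
    by rewrite unitmx1.
  by split; [apply/is_trig_mxP => -[]|case].
have [[a [v [v0 vg]]]|[a [b [x [y [b0 xy xg yg]]]]]] := @real_eigenline_or_plane _ g isT.
  apply: (@trig_dense_block 1 n g v a%:M) => [|||D].
  - by rewrite /row_free rank_rV v0.
  - by rewrite mul_scalar_mx.
  (* A zero eigenvalue is moved to [e / 2]; squaring then makes a nonzero eigenvalue of either sign
     positive. *)
  - move=> e e0; have [a' a'0 a'a] : exists2 a', a' != 0 & `|a' - a| < e.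
      have [->|a0] := eqVneq a 0; last by exists a; rewrite ?subrr ?normr0.
      have e20 : 0 < e / 2 by rewrite divr_gt0.
      exists (e / 2); first by rewrite gt_eqF.
      by rewrite subr0 gtr0_norm// ltr_pdivrMr// ltr_pMr// ltr1n.
    exists a'%:M, 2%N; split => //.
      by move=> i j; rewrite !mxE !ord1 /= !mulr1n.
    split; first exact: mx11_is_trig.
    move=> i; rewrite ord1 expr2 -[_ * _]/(mulmx _ _) -scalar_mxM mxE mulr1n.
    by rewrite -expr2 exprn_even_gt0.
  - exact: IH.
case: n g nm x y xy xg yg => [|n] g nm x y xy xg yg.
  by have := rank_leq_col (col_mx x y); rewrite (eqP xy).
apply: (@trig_dense_block (1 + 1) n g (col_mx x y)
  (block_mx a%:M (- b)%:M b%:M a%:M)) => // [||D].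
- by rewrite mul_col_mx mul_block_col !mul_scalar_mx xg yg scaleNr.
(* The block is [r] times the rotation by [t]. With a nearby rational angle, some power of it is the
   scalar matrix [r ^+ k]. *)
- move=> e e0; pose r := Num.sqrt (a ^+ 2 + b ^+ 2).
  have r0 : 0 < r by rewrite sqrtr_gt0 ltr_wpDl ?sqr_ge0// exprn_even_gt0.
  have r2 : r ^+ 2 = a ^+ 2 + b ^+ 2 by rewrite sqr_sqrtr// addr_ge0 ?sqr_ge0.
  have [|t [t0 ct st]] := @exists_angle _ (a / r) (b / r).
    by rewrite !expr_div_n -mulrDl -r2 divff// expf_neq0// gt_eqF.
  have [s [k [k0 sk sk1]]] := rotmx_rational_dense r t0 e0.
  exists (r *: rotmx s), k; split => //.
    rewrite [block_mx _ _ _ _](_ : _ = r *: rotmx t)//.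
    rewrite /rotmx ct st scale_block_mx !scale_scalar_mx.
    by congr block_mx; congr (_%:M); field; rewrite gt_eqF.
  rewrite exprZ_rotmx sk1; split; first by rewrite scale_scalar_mx scalar_mx_is_trig.
  by move=> i; rewrite scale_scalar_mx mxE eqxx mulr1 exprn_gt0.
- by apply: IH; exact: ltnW.
Qed.

End TriangularPowers.

(** * Simple positive spectrum inside the semigroup *)

Section RegularElements.
Context {R : realType}.

Lemma mxclose_line m n (A B : 'M[R]_(m, n)) (e : R) : 0 < e ->
  exists2 d, 0 < d & forall t, 0 < t < d -> mxclose e (A + t *: B) A.
Proof.
move=> e0; pose K := 1 + \sum_i \sum_j `|B i j|.
have BK i j : `|B i j| < K.
  rewrite /K (bigD1 i)//= (bigD1 j)//= addrCA -addrA ltrDl.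
  rewrite addrCA ltr_wpDr// addr_ge0//; first exact: sumr_ge0.
  by apply: sumr_ge0 => *; apply: sumr_ge0.
have K0 : 0 < K by rewrite ltr_wpDr//; apply: sumr_ge0 => *; apply: sumr_ge0.
exists (e / K) => [|t /andP[t0 td] i j]; first exact: divr_gt0.
rewrite !mxE addrAC subrr add0r normrM (gtr0_norm t0).
rewrite ltr_pdivlMr// in td; apply: le_lt_trans td.
by rewrite ler_wpM2l ?ltW.
Qed.

(** Eigenvectors for distinct eigenvalues are independent: in a relation [u V = 0], multiplication
    by the factors [A - l_i] for all [i] other than [j] leaves only the term of index [j]. *)
Lemma eigenrows_unit n (V A : 'M[R]_n) (l : 'rV_n) :
  V *m A = diag_mx l *m V -> injective (l 0) -> (forall i, row i V != 0) ->
  V \in unitmx.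
Proof.
move=> VA l_inj V0; rewrite -row_free_unit; apply: inj_row_free => u uV.
have H (s : seq 'I_n) :
    (\row_k (u 0 k * \prod_(i <- s) (l 0 k - l 0 i))) *m V = 0.
  elim: s => [|j s IH].
    by rewrite -[RHS]uV; congr (_ *m V); apply/rowP => k; rewrite mxE big_nil mulr1.
  set w := \row__ _ in IH.
  have : w *m diag_mx l *m V - l 0 j *: (w *m V) = 0.
    by rewrite -mulmxA -VA mulmxA IH mul0mx scaler0 subrr.
  rewrite scalemxAl -mulmxBl => <-; congr (_ *m V); apply/rowP => k.
  by rewrite mul_mx_diag !mxE big_cons; ring.
apply/rowP => j; rewrite [RHS]mxE.
have := H [seq i <- enum 'I_n | i != j].
pose w : 'rV_n :=
  (u 0 j * \prod_(i <- [seq i <- enum 'I_n | i != j]) (l 0 j - l 0 i)) *: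
  delta_mx 0 j.
rewrite (_ : \row_k _ = w); last first.
  apply/rowP => k; rewrite !mxE eqxx /=; case: eqVneq => [->|kj]; first by rewrite mulr1.
  have ks : k \in [seq i <- enum 'I_n | i != j] by rewrite mem_filter kj mem_enum.
  rewrite (bigD1_seq k ks); last exact/filter_uniq/enum_uniq.
  by rewrite [X in _ * X](_ : _ = 0) ?mulr0//= subrr mul0r.
rewrite /w -scalemxAl -rowE => /eqP; rewrite scaler_eq0 (negPf (V0 j)) orbF mulf_eq0.
case/orP => [/eqP//|]; rewrite prodf_seq_eq0 => /hasP[k].
by rewrite mem_filter /= subr_eq0 => /andP[/eqP kj _] /eqP /l_inj /esym.
Qed.

Lemma sorting_perm n (l : 'I_n -> R) : injective l ->
  exists s : 'S_n, forall i j : 'I_n, (i < j)%N -> l (s j) < l (s i).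
Proof.
move=> l_inj; pose ge := fun x y : R => y <= x.
pose t := [tuple l i | i < n]; pose u := [tuple of sort ge t].
have /tuple_permP[s uE] : perm_eq u t by exact/permEl/perm_sort.
exists s => i j ij.
have ue k : l (s k) = nth 0 u k.
  have := congr1 (fun v => tnth v k) (val_inj uE).
  by rewrite tnth_mktuple tnth_mktuple (tnth_nth 0) => ->.
rewrite lt_neqAle (inj_eq l_inj) (inj_eq perm_inj) [_ == _]eq_sym neq_ltn ij /=.
rewrite !ue; have ge_total : total ge by move=> x y; exact: le_total.
have ge_trans : transitive ge by move=> y x z xy yz; exact: le_trans yz xy.
apply: (sorted_ltn_nth ge_trans) => //; first exact: sort_sorted.
  by rewrite inE size_tuple.
by rewrite inE size_tuple.
Qed.

(** The diagonal entries are the roots of the characteristic polynomial; being distinct, they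
    provide a basis of left eigenvectors, here listed by decreasing eigenvalue. *)
Lemma trig_diagonalize n (T : 'M[R]_n) : is_trig_mx T ->
  injective (fun i => T i i) ->
  exists (V : 'M[R]_n) (s : 'S_n), [/\ V \in unitmx,
    V *m T = diag_mx (\row_i T (s i) (s i)) *m V &
    forall i j : 'I_n, (i < j)%N -> T (s j) (s j) < T (s i) (s i)].
Proof.
move=> Tt T_inj; have [s s_lt] := sorting_perm T_inj.
have ev i : exists v : 'rV_n, v *m T = T (s i) (s i) *: v /\ v != 0.
  have /eigenvalueP[v vT v0] : eigenvalue T (T (s i) (s i)).
    rewrite eigenvalue_root_char char_poly_trig// /root.
    by rewrite horner_prod (bigD1 (s i))//= !hornerE subrr mul0r.
  by exists v.
have [v vP] := choice ev.
pose V := \matrix_(i < n) v i.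
have VT : V *m T = diag_mx (\row_i T (s i) (s i)) *m V.
  apply/row_matrixP => i; rewrite row_mul rowK (vP i).1.
  by apply/rowP => j; rewrite mul_diag_mx !mxE.
exists V, s; split => //; apply: (eigenrows_unit VT) => [i j|i].
  by rewrite !mxE => /T_inj /perm_inj.
by rewrite rowK (vP i).2.
Qed.

(* If [g' ^+ k] is triangular with positive diagonal, multiplying it on the right
   by a matrix close to [1] separates its eigenvalues; the product stays in [T]
   because only one factor [g'] is moved. *)
Lemma semigroup_regular_element n (T : set 'M[R]_n) (g : 'M[R]_n) (e : R) :
  (forall A B, T A -> T B -> T (A *m B)) -> 0 < e ->
  (forall A, mxclose e A g -> T A) ->
  exists Q (l : 'I_n -> R), [/\ Q \in unitmx, forall i, 0 < l i,
    forall i j : 'I_n, (i < j)%N -> l j < l i &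
    T (Q *m diag_mx (\row_i l i) *m invmx Q)].
Proof.
move=> TM e0 Tg; have e20 : 0 < e / 2 by lra.
have [g' [k [Q [g'g k0 Qu [Xt X0]]]]] := @trig_dense_all R n g _ e20.
set X := Q *m _ *m _ in Xt X0.
have XE : invmx Q *m X = g' ^+ k *m invmx Q by rewrite /X !mulmxA mulVmx// mul1mx.
clearbody X.
(* [D 0] is the identity, and [D 1] turns the diagonal of [X] into [1, 2, ..., n], which are
   distinct. *)
pose D t : 'rV[R]_n := \row_i (1 + t * (i.+1%:R / X i i - 1)).
pose F : 'rV[R]_n := \row_i (i.+1%:R / X i i - 1).
have DE t : diag_mx (D t) = 1%:M + t *: diag_mx F.
  by apply/matrixP => i j; rewrite !mxE; case: eqP => _; rewrite ?mulr1n ?mulr0n; ring.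
have [d d0 hd] := mxclose_line g' (g' *m (invmx Q *m diag_mx F *m Q)) e20.
(* [f t] is nonzero exactly when the diagonal entries of [X *m diag_mx (D t)] are distinct. *)
pose f t := \prod_(i < n) \prod_(j < n | i != j)
  (X i i * D t 0 i - X j j * D t 0 j).
have fp : polyfun f.
  do 2 (apply: polyfun_prod => ?); under eq_fun do rewrite !mxE.
  apply: polyfunD; first by apply: polyfunM; [exact: polyfun_cst|exact: polyfun_line].
  under eq_fun do rewrite -mulNr.
  by apply: polyfunM; [exact: polyfun_cst|exact: polyfun_line].
have f1 : f 1 != 0.
  apply/prodf_neq0 => i _; apply/prodf_neq0 => j ij.
  rewrite !mxE !mul1r ![1 + _]addrC !subrK ![X _ _ * _]mulrC.
  rewrite !divfK; try by rewrite gt_eqF ?X0.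
  by rewrite subr_eq0 eqr_nat eqSS.
(* The bound by [d] keeps the perturbed factor near [g]; the bound by [1] keeps [D t], a convex
   combination of positive numbers, positive. *)
have d10 : 0 < Num.min d 1 by rewrite lt_min d0 /=.
have [t /andP[t0]] := polyfun_small_neq0 fp f1 d10.
rewrite lt_min => /andP[td t1] ft.
pose Y := X *m diag_mx (D t).
have Yt : is_trig_mx Y by apply: is_trig_mulmx => //; exact: diag_mx_is_trig.
have YE i : Y i i = X i i * D t 0 i by rewrite /Y mul_mx_diag mxE.
have Y_inj : injective (fun i => Y i i).
  move=> i j; rewrite !YE => ij; apply: contraNeq ft => ne_ij.
  by rewrite /f (bigD1 i)//= [X in X * _](bigD1 j)//= ij subrr !mul0r.
have Y0 i : 0 < Y i i.
  rewrite YE mulr_gt0// mxE.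
  have : 0 < t * (i.+1%:R / X i i) by rewrite mulr_gt0 ?divr_gt0 ?ltr0n.
  by lra.
have [V [s [Vu VY s_lt]]] := trig_diagonalize Yt Y_inj.
exists (invmx (V *m Q)), (fun i => Y (s i) (s i)).
have VQu : V *m Q \in unitmx by rewrite unitmx_mul Vu.
split => //; first by rewrite unitmx_inv.
rewrite invmxK mulmxA.
have -> : invmx (V *m Q) *m diag_mx (\row_i Y (s i) (s i)) *m V *m Q =
          invmx Q *m Y *m Q.
  rewrite -[_ *m V]mulmxA -VY invmxM// !mulmxA mulmxKV//.
have -> : invmx Q *m Y *m Q = g' ^+ k.-1 *m (g' *m (invmx Q *m diag_mx (D t) *m Q)).
  rewrite mulmxA -[g' ^+ _ *m g'](_ : g' ^+ k = _); last by rewrite -{1}(prednK k0) exprSr.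
  by rewrite /Y !mulmxA XE.
have Tg' : T g'.
  by apply: Tg => i j; have := g'g i j; lra.
have Tg'E : T (g' *m (invmx Q *m diag_mx (D t) *m Q)).
  apply: Tg => i j; rewrite DE mulmxDr mulmx1 mulmxDl mulVmx// mulmxDr mulmx1.
  rewrite -scalemxAr -scalemxAl -scalemxAr.
  have := hd t _ i j; rewrite t0 td => /(_ isT) h1; have h2 := g'g i j.
  move: h1 h2; set a := fun_of_matrix (g' + _) i j => h1 h2.
  rewrite (_ : a - g i j = (a - g' i j) + (g' i j - g i j)); last by ring.
  by apply: le_lt_trans (ler_normD _ _) _; lra.
elim: k.-1 => [|m IH]; first by rewrite expr0 mul1mx.
by rewrite exprS -[_ * _]/(g' *m g' ^+ m) -mulmxA; apply: TM.
Qed.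
End RegularElements.

(** * Exterior powers *)

Section ExteriorAlgebra.
Context {R : realType} {k d : nat}.
Notation N := #|{: incr_map k d}|.
Notation idx a := (val (enum_val a : incr_map k d) : 'I_k -> 'I_d).
Implicit Types (w : ext R k d) (A B : 'M[R]_d) (U : 'M[R]_(d, k)).

Lemma wedge_mulmx U (C : 'M[R]_k) : wedge (U *m C) = \det C *: wedge U.
Proof.
by apply/colP => a; rewrite !mxE -mul_rowsub_mx det_mulmx mulrC.
Qed.

Lemma wedge_colsub A a : wedge (colsub (idx a) A) = ext_act A (delta_mx a 0).
Proof. by rewrite -wedge_basis ext_act_wedge mulmx_colsub mulmx1. Qed.

Lemma ext_actD A w w' : ext_act A (w + w') = ext_act A w + ext_act A w'.
Proof. by rewrite -big_split; apply: eq_bigr => a _; rewrite mxE scalerDl. Qed.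

Lemma ext_actZ A c w : ext_act A (c *: w) = c *: ext_act A w.
Proof. by rewrite scaler_sumr; apply: eq_bigr => a _; rewrite mxE scalerA. Qed.

Lemma ext_act_sum A (I : Type) (r : seq I) (P : pred I) (F : I -> ext R k d) :
  ext_act A (\sum_(i <- r | P i) F i) = \sum_(i <- r | P i) ext_act A (F i).
Proof.
apply: (big_morph (ext_act A)); first exact: ext_actD.
by rewrite /ext_act big1 // => a _; rewrite mxE scale0r.
Qed.

Lemma ext_actM A B w : ext_act (A *m B) w = ext_act A (ext_act B w).
Proof.
rewrite [X in _ = ext_act A X]/ext_act ext_act_sum; apply: eq_bigr => a _.
by rewrite ext_actZ ext_act_wedge mulmx_colsub.
Qed.

Lemma cV_sum_delta n (v : 'cV[R]_n) : v = \sum_a v a 0 *: delta_mx a 0.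
Proof. by rewrite {1}[v]matrix_sum_delta; apply: eq_bigr => a _; rewrite big_ord1. Qed.

Lemma ext_actZl c A w : ext_act (c *: A) w = c ^+ k *: ext_act A w.
Proof.
rewrite scaler_sumr; apply: eq_bigr => a _; rewrite scalerA mulrC -scalerA.
congr (_ *: _); rewrite -[c ^+ k](det_scalar k) -wedge_mulmx mul_mx_scalar.
by congr wedge; apply/matrixP => i j; rewrite !mxE.
Qed.

Lemma ext_act_diag (l : 'I_d -> R) w a :
  ext_act (diag_mx (\row_i l i)) w a 0 = (\prod_i l (idx a i)) * w a 0.
Proof.
have E b : ext_act (diag_mx (\row_i l i)) (delta_mx b 0) =
    (\prod_i l (idx b i)) *: delta_mx b 0 :> ext R k d.
  rewrite -wedge_colsub -wedge_basis.
  have -> : colsub (idx b) (diag_mx (\row_i l i)) =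
      colsub (idx b) 1%:M *m diag_mx (\row_i l (idx b i)).
    apply/matrixP => i j; rewrite mul_mx_diag !mxE.
    by case: eqP => [->|_]; rewrite ?mulr1n ?mul1r ?mulr0n ?mul0r.
  by rewrite wedge_mulmx det_diag; congr (_ *: _); apply: eq_bigr => i _; rewrite mxE.
rewrite {1}[w]cV_sum_delta ext_act_sum summxE (bigD1 a)//= big1 ?addr0.
  by rewrite ext_actZ E !mxE !eqxx mulr1 mulrC.
by move=> b ba; rewrite ext_actZ E !mxE eq_sym (negPf ba) !mulr0.
Qed.

Lemma ext_act_mulmx (U : 'M[R]_(d, k)) (V : 'M[R]_(k, d)) w :
  ext_act (U *m V) w = (\sum_a w a 0 * \det (colsub (idx a) V)) *: wedge U.
Proof.
rewrite scaler_suml; apply: eq_bigr => a _.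
by rewrite -scalerA -wedge_mulmx mulmx_colsub.
Qed.

(** A substitute for irreducibility: if [w] has a nonzero coordinate [a] and [f] a nonzero
    coordinate [b], the partial permutation matrix sending the basis vectors of [a] to those of [b]
    maps [w] to [w_a] times the basis vector [b]. It may be singular, so it is reached from the
    semigroup only through a polynomial argument. *)
Lemma ext_act_nondegenerate (f : 'rV[R]_N) w : f != 0 -> w != 0 ->
  exists A, (f *m ext_act A w) 0 0 != 0.
Proof.
move=> /rV0Pn[b fb] /cV0Pn[a wa].
exists (colsub (idx b) 1%:M *m rowsub (idx a) 1%:M).
rewrite ext_act_mulmx wedge_basis -scalemxAr -colE !mxE mulf_neq0//.
rewrite (bigD1 a)//= big1 ?addr0 => [|c ca].
  suff -> : colsub (idx a) (rowsub (idx a) 1%:M) = 1%:M :> 'M[R]_k.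
    by rewrite det1 mulr1.
  by apply/matrixP => i j; rewrite !mxE (inj_eq (@incr_map_inj _ _ _)).
(* The minor in question is the coordinate [a] of the basis vector [c], once column and row
   selection are exchanged. *)
have /colP/(_ a) := wedge_basis (R := R) c; rewrite !mxE eq_sym (negPf ca) /= => h.
suff -> : colsub (idx c) (rowsub (idx a) 1%:M) =
  rowsub (idx a) (colsub (idx c) 1%:M) :> 'M[R]_k by rewrite h mulr0.
by apply/matrixP => i j; rewrite !mxE.
Qed.

Lemma polyfun_ext_act (f : 'rV[R]_N) w (P A B : 'M[R]_d) :
  polyfun (fun t => (f *m ext_act (P *m (A + t *: B)) w) 0 0).
Proof.
under eq_fun do rewrite mxE.
apply: polyfun_sum => b; apply: polyfunM; first exact: polyfun_cst.
under eq_fun do rewrite summxE.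
apply: polyfun_sum => a; under eq_fun do rewrite !mxE.
apply: polyfunM; first exact: polyfun_cst.
apply: polyfun_det => i j; under eq_fun do rewrite !mxE.
apply: polyfun_sum => l; apply: polyfunM; first exact: polyfun_cst.
by under eq_fun do rewrite !mxE; exact: polyfun_line.
Qed.

(** By the Cauchy-Binet formula, [\det (V *m U) = 1] is a combination of the coordinates of
    [wedge U]. *)
Lemma wedge_neq0 U (V : 'M[R]_(k, d)) : V *m U = 1%:M -> wedge U != 0.
Proof.
move=> VU; apply/eqP => U0; have := det1 R k; rewrite -VU det_mulmx_incr.
rewrite big1 => [/eqP|f _]; first by rewrite eq_sym oner_eq0.
have /colP/(_ (enum_rank f)) := U0; rewrite !mxE enum_rankK => ->.
by rewrite mulr0.
Qed.

Lemma wedge_multilinear (j : 'I_k) (U V W : 'M[R]_(d, k)) t :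
  (forall i, W i j = U i j + t * V i j) ->
  (forall i l, l != j -> V i l = U i l /\ W i l = U i l) ->
  wedge W = wedge U + t *: wedge V.
Proof.
move=> Wj Wl; apply/colP => a; rewrite !mxE -[LHS]det_tr -[\det (rowsub _ U)]det_tr.
rewrite -[\det (rowsub _ V)]det_tr -[\det _^T as X in _ = X + _]mul1r.
apply: (@determinant_multilinear _ _ _ _ _ j).
- by apply/rowP => i; rewrite !mxE Wj mul1r.
- by apply/matrixP => l i; rewrite !mxE; case: (Wl (idx a i) (lift j l)) => //;
    rewrite eq_sym neq_lift.
- apply/matrixP => l i; rewrite !mxE; case: (Wl (idx a i) (lift j l)) => [|-> ->//].
  by rewrite eq_sym neq_lift.
Qed.

Lemma incr_map_ge (f : incr_map k d) (i : 'I_k) : (i <= val f i)%N.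
Proof.
case: i => i; elim: i => // i IH ik; have ik' := ltnW ik.
apply: leq_ltn_trans (IH ik') _; exact: incr_mapP.
Qed.

(* [a0] is the index of [e_0 /\ ... /\ e_(k-1)], the dominant weight vector. *)
Lemma wedge_pid_mx : (k <= d)%N -> exists a0 : 'I_N,
  wedge (pid_mx k) = delta_mx a0 0 :> ext R k d /\
  forall l : 'I_d -> R, (forall i, 0 < l i) ->
    (forall i j : 'I_d, (i < j)%N -> l j < l i) ->
  forall a, a != a0 -> \prod_i l (idx a i) < \prod_i l (idx a0 i).
Proof.
move=> kd; have f_incr : [forall i : 'I_k, forall j : 'I_k, (i < j)%N ==>
    ([ffun i => widen_ord kd i] i < [ffun i => widen_ord kd i] j)%N].
  by apply/forallP => i; apply/forallP => j; apply/implyP => ij; rewrite !ffunE.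
pose f : incr_map k d := exist _ [ffun i => widen_ord kd i] f_incr.
exists (enum_rank f); split.
  rewrite -wedge_basis enum_rankK; congr wedge; apply/matrixP => i j.
  by rewrite !mxE ffunE -val_eqE /=; case: eqP => //= ->; rewrite ltn_ord.
move=> l l0 l_lt a ne; rewrite enum_rankK.
have fi i : val (val f i) = i by rewrite ffunE.
(* An increasing map satisfies [i <= f i], so where [a] differs from the initial one its index is
   strictly larger and its eigenvalue strictly smaller. *)
have [i ni] : exists i, val (val f i) != idx a i.
  apply: contrapT => nex; case/eqP: ne; apply: enum_val_inj.
  rewrite enum_rankK; apply: incr_map_eq => i; exists i; apply: val_inj.
  by apply/eqP; apply: contrapT => /negP h; apply: nex; exists i; rewrite eq_sym.
rewrite (bigD1 i)//= [ltRHS](bigD1 i)//=.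
have le_l j : l (idx a j) <= l (val f j).
  have := incr_map_ge (enum_val a) j; rewrite -{1}[nat_of_ord j]fi leq_eqVlt.
  by case/orP => [/eqP/val_inj ->//|/l_lt/ltW].
apply: (@lt_le_trans _ _ (l (val f i) * \prod_(j | j != i) l (idx a j))).
  rewrite ltr_pM2r ?prodr_gt0//; apply: l_lt.
  rewrite ltn_neqAle ni fi; exact: incr_map_ge.
by rewrite ler_wpM2l ?(ltW (l0 _))//; apply: ler_prod => j _; rewrite le_l ltW.
Qed.

End ExteriorAlgebra.

(** * Topology of matrices and of the cone over a semigroup *)

Section MatrixTopology.
Context {R : realType}.

Lemma cvg_mx (T : Type) (F : set_system T) {FF : Filter F} m n
    (f : T -> 'M[R]_(m, n)) (l : 'M[R]_(m, n)) :
  (forall i j, (fun t => f t i j) @ F --> l i j) -> f @ F --> l.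
Proof.
move=> fl A [P lP PA].
have : \forall t \near F, forall ij, P ij.1 ij.2 (f t ij.1 ij.2).
  by apply: filter_forall => -[i j]; exact: (fl i j _ (lP i j)).
by apply: filterS => t tP; apply: PA => i j; exact: (tP (i, j)).
Qed.

Lemma cvg_sumr (V : normedModType R) (T I : Type) (F : set_system T)
    {FF : Filter F} (r : seq I) (P : pred I) (f : I -> T -> V) (l : I -> V) :
  (forall i, P i -> f i @ F --> l i) ->
  (fun t => \sum_(i <- r | P i) f i t) @ F --> \sum_(i <- r | P i) l i.
Proof.
move=> fl; elim: r => [|i r IH].
  by rewrite big_nil; under eq_fun do rewrite big_nil; exact: cvg_cst.
rewrite big_cons; under eq_fun do rewrite big_cons.
by case: ifPn => // Pi; apply: cvgD => //; exact: fl.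
Qed.

Lemma cvg_prodr (T I : Type) (F : set_system T)
    {FF : Filter F} (r : seq I) (P : pred I) (f : I -> T -> R) (l : I -> R) :
  (forall i, P i -> f i @ F --> l i) ->
  (fun t => \prod_(i <- r | P i) f i t) @ F --> \prod_(i <- r | P i) l i.
Proof.
move=> fl; elim: r => [|i r IH].
  by rewrite big_nil; under eq_fun do rewrite big_nil; exact: cvg_cst.
rewrite big_cons; under eq_fun do rewrite big_cons.
by case: ifPn => // Pi; apply: cvgM => //; exact: fl.
Qed.

Lemma cvg_coord (T : Type) (F : set_system T) {FF : Filter F} m n
    (f : T -> 'M[R]_(m, n)) (l : 'M[R]_(m, n)) i j :
  f @ F --> l -> (fun t => f t i j) @ F --> l i j.
Proof.
move=> fl; apply: (cvg_comp f (fun M : 'M[R]_(m, n) => M i j) fl).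
exact: coord_continuous.
Qed.

Lemma cvg_mulmx (T : Type) (F : set_system T) {FF : Filter F} m n p
    (f : T -> 'M[R]_(m, n)) (g : T -> 'M[R]_(n, p))
    (l : 'M[R]_(m, n)) (l' : 'M[R]_(n, p)) :
  f @ F --> l -> g @ F --> l' -> (fun t => f t *m g t) @ F --> l *m l'.
Proof.
move=> fl gl; apply: cvg_mx => i j; rewrite mxE; under eq_fun do rewrite mxE.
by apply: cvg_sumr => k _; apply: cvgM; exact: cvg_coord.
Qed.

Lemma cvg_det (T : Type) (F : set_system T) {FF : Filter F} n
    (f : T -> 'M[R]_n) (l : 'M[R]_n) : f @ F --> l -> (fun t => \det (f t)) @ F --> \det l.
Proof.
move=> fl; apply: cvg_sumr => s _; apply: cvgM; first exact: cvg_cst.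
by apply: cvg_prodr => i _; exact: cvg_coord.
Qed.

Lemma cvg_wedge (T : Type) (F : set_system T) {FF : Filter F} k d
    (f : T -> 'M[R]_(d, k)) (l : 'M[R]_(d, k)) :
  f @ F --> l -> (fun t => wedge (f t)) @ F --> wedge l.
Proof.
move=> fl; apply: cvg_mx => a j; rewrite mxE; under eq_fun do rewrite mxE.
apply: cvg_det; apply: cvg_mx => i l'; rewrite mxE; under eq_fun do rewrite mxE.
exact: cvg_coord.
Qed.

Lemma nbhs_mxclose m n (A : 'M[R]_(m, n)) (U : set 'M[R]_(m, n)) :
  nbhs A U -> exists2 e, 0 < e & forall B, mxclose e B A -> U B.
Proof.
move=> /nbhs_ballP[e /= e0 eU]; exists e => // B BA.
by apply: eU; split => // i j; rewrite /ball /= distrC; exact: BA.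
Qed.

Lemma open_SL d (O : set (SL R d)) :
  open O -> exists2 U, open U & O = val @^-1` U.
Proof. by move=> [U oU <-]; exists U. Qed.

Lemma open_val_SL d (U : set 'M[R]_d) : open U -> open [set g : SL R d | U (val g)].
Proof. by move=> oU; exists U. Qed.

(** The set [T] of the overview. Perturbations in it need not preserve the determinant, and positive
    factors change neither the action on flags nor membership in a cone. *)
Definition cone_over d (S : set (SL R d)) : set 'M[R]_d :=
  [set A | exists c (s : SL R d), [/\ 0 < c, S s & A = c *: val s]].

Lemma cone_overM d (S : set (SL R d)) A B : semigroup S ->
  cone_over S A -> cone_over S B -> cone_over S (A *m B).
Proof.
move=> SS [a [s [a0 Ss ->]]] [b [t [b0 St ->]]].
exists (a * b), (SL_mul s t); split; [exact: mulr_gt0|exact: SS|].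
by rewrite /= -scalemxAl -scalemxAr scalerA.
Qed.

Lemma cone_over_unit d (S : set (SL R d)) A : cone_over S A -> A \in unitmx.
Proof.
by move=> [c [s [c0 _ ->]]]; rewrite unitmxZ ?SL_unit// unitfE gt_eqF.
Qed.

(* The normalisation [A |-> A / (det A)^(1/d)] is continuous near [SL]. *)
Lemma cone_over_ball d (S : set (SL R d)) : (0 < d)%N -> S° !=set0 ->
  exists (g : 'M[R]_d) e, 0 < e /\ forall A, mxclose e A g -> cone_over S A.
Proof.
move=> d0 [g]; rewrite /interior nbhsE => -[V [/open_SL[U oU VE] Vg] VS].
pose f (A : 'M[R]_d) := expR (- ln (\det A) / d%:R) *: A.
have f_cvg : f @ nbhs (val g) --> val g.
  have fg : f (val g) = val g.
    by rewrite /f SL_det ln1 oppr0 mul0r expR0 scale1r.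
  rewrite -[X in _ --> X]fg; apply: cvgZ; last exact: cvg_id.
  apply: cvg_comp; last exact: continuous_expR.
  apply: cvgM; last exact: cvg_cst.
  apply: cvgN; apply: cvg_comp; last by apply: continuous_ln; rewrite SL_det.
  by apply: cvg_det.
have Ug : U (val g) by have := Vg; rewrite VE.
have near_det : \forall A \near val g, 0 < \det A.
  have h : (fun A : 'M[R]_d => \det A) @ nbhs (val g) --> \det (val g) by exact: cvg_det.
  by apply: (h [set x : R | 0 < x]); rewrite SL_det; exact: lt_nbhsr.
have near_U : \forall A \near val g, U (f A) by apply: (f_cvg U); exact: open_nbhs_nbhs.
have [e e0 he] := nbhs_mxclose (filterI near_det near_U).
exists (val g), e; split => // A /he[detA UA].
have fA1 : \det (f A) = 1.
  rewrite /f detZ -expRM_natr divfK ?pnatr_eq0 -?lt0n//.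
  by rewrite expRN lnK ?posrE// mulVf ?gt_eqF.
pose s : SL R d := exist _ (f A) (mem_set fA1).
exists (expR (ln (\det A) / d%:R)), s; split; first exact: expR_gt0.
  by apply: VS; rewrite VE.
by rewrite /= /f scalerA -expRD -mulrDl subrr mul0r expR0 scale1r.
Qed.

End MatrixTopology.

(** * Flags *)

Section Flags.
Context {R : realType} {d : nat}.

Lemma mem_flag_act (Theta : set nat) (g : SL R d) (V : flag R d Theta) r u :
  u \in flag_act g V r <-> exists2 v, v \in V r & u = val g *m v.
Proof.
split=> [/memv_imgP[v vV ->]|[v vV ->]].
  by exists v => //; rewrite lfunE.
by apply/memv_imgP; exists v => //; rewrite lfunE.
Qed.

Lemma flag_ext (Theta : set nat) (V V' : flag R d Theta) :
  (forall r, V r = V' r) -> V = V'.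
Proof.
case: V V' => [V Vd Vi] [V' V'd V'i] /= VV'.
have {}VV' : V = V' by apply/funext.
case: _ / VV' V'd V'i => V'd V'i.
by congr Flag; exact: Prop_irrelevance.
Qed.

Lemma flag_eq_sub (Theta : set nat) (V V' : flag R d Theta) :
  (forall r v, v \in V r -> v \in V' r) -> V = V'.
Proof.
move=> VV'; apply: flag_ext => r; apply/eqP.
by rewrite eqEdim !flag_dim leqnn andbT; apply/subvP => v; exact: VV'.
Qed.

Lemma flag_act_mul (Theta : set nat) (g h : SL R d) (V : flag R d Theta) :
  flag_act (SL_mul g h) V = flag_act g (flag_act h V).
Proof.
apply: flag_eq_sub => r _ /mem_flag_act[v vV ->].
apply/mem_flag_act; exists (val h *m v); last by rewrite mulmxA.
by apply/mem_flag_act; exists v.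
Qed.

Lemma flag_openE (Theta : set nat) (A : set (flag R d Theta)) :
  open A = flag_open A.
Proof. by []. Qed.

Lemma flag_act_continuous (Theta : set nat) (g : SL R d) :
  continuous (flag_act g : flag R d Theta -> flag R d Theta).
Proof.
apply/continuousP => A oA; rewrite flag_openE => V.
rewrite flag_openE in oA.
have [U oU UE] := open_SL (oA V).
(* The orbit map of [V] followed by [g] is the orbit map of [V] after left translation by [g], which
   is continuous on matrices. *)
rewrite (_ : [set _ | _] = [set h : SL R d | U (val g *m val h)]).
  apply: (@open_val_SL _ _ (fun X => U (val g *m X))).
  apply: (@open_comp _ _ (fun X : 'M[R]_d => val g *m X)) => // X _.
  exact: (@cvg_mulmx _ _ (nbhs X) _ _ _ _ (fun=> val g) id (val g) X (cvg_cst _) cvg_id).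
apply/funext => h; rewrite /= -flag_act_mul.
have /(congr1 (fun P => P (SL_mul g h))) := UE; exact.
Qed.

Lemma closure_flag_act (Theta : set nat) (S : set (SL R d))
    (V V' : flag R d Theta) g : semigroup S -> S g ->
  closure [set flag_act s V | s in S] V' ->
  closure [set flag_act s V | s in S] (flag_act g V').
Proof.
move=> SS Sg clV' B nB.
have [_ [[s Ss <-] Bs]] := clV' _ (@flag_act_continuous Theta g V' B nB).
exists (flag_act g (flag_act s V)); split => //.
by exists (SL_mul g s); [exact: SS|rewrite flag_act_mul].
Qed.

Lemma closure_orbit_sub (Theta : set nat) (S : set (SL R d))
    (V V' : flag R d Theta) : semigroup S ->
  closure [set flag_act s V | s in S] V' ->
  closure [set flag_act s V' | s in S] `<=` closure [set flag_act s V | s in S].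
Proof.
move=> SS clV'.
rewrite [X in _ `<=` X]((closure_id (closure _)).1 (@closed_closure _ _)).
apply: closureS => _ [s Ss <-]; exact: closure_flag_act.
Qed.

(** The [r]-dimensional member of the standard flag, spanned by [e_0, ..., e_(r-1)]. *)
Definition low (r : nat) (c : 'cV[R]_d) := forall i : 'I_d, (r <= i)%N -> c i 0 = 0.

Lemma mulmx_pid_low m r (C : 'M[R]_(d, m)) :
  (forall (i : 'I_d) j, (r <= i)%N -> C i j = 0) ->
  pid_mx r *m ((pid_mx r : 'M[R]_(r, d)) *m C) = C.
Proof.
move=> Cr; rewrite mulmxA mul_pid_mx !minnn; apply/matrixP => i j.
rewrite mxE (bigD1 i)//= big1 ?addr0 => [|a ai].
  by rewrite mxE eqxx /=; case: ltnP => [|/Cr ->]; rewrite ?mul1r ?mulr0.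
by rewrite mxE eq_sym (inj_eq val_inj) (negPf ai) mul0r.
Qed.

Section FlagOf.
Context (M : 'M[R]_d) (Mu : M \in unitmx).

Definition flag_of_space (r : ThetaM d) : {vspace 'cV[R]_d} :=
  limg (linfun (mulmx (M *m pid_mx (val r) : 'M[R]_(d, val r)))).

Lemma mem_flag_of_space r v :
  v \in flag_of_space r <-> exists2 c, low (val r) c & v = M *m c.
Proof.
split=> [/memv_imgP[c _ ->]|[c cr ->]].
  rewrite lfunE /= -mulmxA; exists (pid_mx (val r) *m c) => // i ri.
  rewrite mxE big1// => j _; rewrite mxE ltnNge ri andbF mul0r//.
apply/memv_imgP; exists (pid_mx (val r) *m c); first exact: memvf.
by rewrite lfunE /= -mulmxA mulmx_pid_low// => i j ri; rewrite ord1 cr.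
Qed.

Fact flag_of_dim r : \dim (flag_of_space r) = val r.
Proof.
have rd : (val r <= d)%N by have /andP[_ /ltnW] := set_mem (valP r).
rewrite limg_dim_eq; first by rewrite dimvf /dim /= muln1.
apply/eqP; rewrite -subv0; apply/subvP => c; rewrite memv_cap memv_ker => /andP[_].
rewrite lfunE /= memv0 -mulmxA => /eqP /(congr1 (mulmx (invmx M))).
rewrite mulKmx// mulmx0 => /(congr1 (mulmx (pid_mx (val r) : 'M[R]_(val r, d)))).
rewrite mulmxA mul_pid_mx mulmx0 !minnn (minn_idPr _)// pid_mx_1 mul1mx.
by move=> ->.
Qed.

Fact flag_of_incl (r s : ThetaM d) : (val r <= val s)%N ->
  (flag_of_space r <= flag_of_space s)%VS.
Proof.
move=> rs; apply/subvP => v /mem_flag_of_space[c cr ->].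
apply/mem_flag_of_space; exists c => // i si; apply: cr; exact: leq_trans si.
Qed.

Definition flag_of : flag R d (ThetaM d) := Flag flag_of_dim flag_of_incl.

Lemma mem_flag_of r v : v \in flag_of r <-> exists2 c, low (val r) c & v = M *m c.
Proof. exact: mem_flag_of_space. Qed.

End FlagOf.

(** Extends a full flag by its trivial members of dimension [0] and [d], so that the choice of an
    adapted basis is uniform. *)
Lemma flag_level (V : flag R d (ThetaM d)) r : (r <= d)%N ->
  exists Y : {vspace 'cV[R]_d}, [/\ \dim Y = r,
    forall s : ThetaM d, (val s <= r)%N -> (V s <= Y)%VS &
    forall s : ThetaM d, (r <= val s)%N -> (Y <= V s)%VS].
Proof.
move=> rd; have [->|r0] := posnP r.
  exists 0%VS; split=> [|s s0|s _]; rewrite ?dimv0 ?sub0v//.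
  by have /andP[] := set_mem (valP s); rewrite lt0n -leqn0 s0.
move: rd; rewrite leq_eqVlt => /orP[/eqP->|rd].
  exists fullv; split=> [|s _|s ds]; rewrite ?dimvf /dim /= ?muln1 ?subvf//.
  by have /andP[_] := set_mem (valP s); rewrite ltnNge ds.
have rT : r \in ThetaM d by apply: mem_set; rewrite /ThetaM/= r0 rd.
by exists (V (exist _ r rT)); split=> [|s sr|s rs]; rewrite ?flag_dim// flag_incl.
Qed.

(** The column [j] of [M] is chosen in the member of dimension [j + 1] but outside that of dimension
    [j]. *)
Lemma flag_basis (V : flag R d (ThetaM d)) :
  exists (M : 'M[R]_d) (Mu : M \in unitmx), V = flag_of Mu.
Proof.
have ex (j : 'I_d) : exists v : 'cV[R]_d,
    [/\ v != 0, forall s : ThetaM d, (j < val s)%N -> v \in V s &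
     forall s : ThetaM d, (val s <= j)%N -> v \notin V s].
  have [Y [Yd Y1 Y2]] := flag_level V (ltnW (ltn_ord j)).
  have [Z [Zd Z1 Z2]] := flag_level V (ltn_ord j).
  have : ~~ (Z <= Y)%VS.
    by apply/negP => /dimvS; rewrite Yd Zd ltnn.
  move=> /subvPn[v vZ vY]; exists v; split.
  - by apply: contraNneq vY => ->; exact: mem0v.
  - by move=> s js; exact: (subvP (Z2 s js)).
  - by move=> s sj; apply: contra vY; exact: (subvP (Y1 s sj)).
have [v vP] := choice ex.
pose M := \matrix_(i < d, j < d) v j i 0.
have ME c : M *m c = \sum_j c j 0 *: v j.
  by apply/colP => i; rewrite mxE summxE; apply: eq_bigr => j _; rewrite !mxE mulrC.
have Mu : M \in unitmx.
  rewrite -unitmx_tr -row_free_unit; apply: inj_row_free => u uM.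
  pose c := u^T; have Mc0 : M *m c = 0 by rewrite -[LHS]trmxK trmx_mul trmxK uM trmx0.
  suff c0 : c = 0 by rewrite -[u]trmxK -/c c0 trmx0.
  apply/eqP/negPn/negP => /cV0Pn[i0 ci0].
  (* At the last nonzero coefficient [j] of a relation, [v j] is a combination of earlier vectors,
     hence lies in the member of dimension [j], or is zero if [j = 0]. *)
  have [j cj jmax] := @arg_maxnP _ i0 (fun i => c i 0 != 0) (fun i => nat_of_ord i) ci0.
  have vj : v j = \sum_(i < d | (i < j)%N) (- (c j 0)^-1 * c i 0) *: v i.
    have : \sum_(i < d | (i < j)%N) c i 0 *: v i + c j 0 *: v j = 0.
      rewrite -[RHS]Mc0 ME [RHS](bigD1 j)//= addrC; congr (_ + _).
      rewrite [RHS](bigID (fun i : 'I_d => (i < j)%N))/= [X in _ + X]big1 ?addr0.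
        by apply: eq_bigl => i; case: ltngtP; rewrite ?andbF ?andbT// => ij;
          rewrite neq_ltn ij.
      move=> i /andP[ij]; rewrite -leqNgt => ji.
      have [ci|] := eqVneq (c i 0) 0; first by rewrite ci scale0r.
      move=> /jmax ij'; case/eqP: ij; apply: val_inj; apply/eqP.
      by rewrite eqn_leq ji andbT; exact: ij'.
    move=> /eqP; rewrite addr_eq0 => /eqP h.
    rewrite -[LHS](scalerK cj) -[c j 0 *: v j]opprK -h scalerN -scaleNr scaler_sumr.
    by apply: eq_bigr => i _; rewrite scalerA.
  have [vj0 _ vjn] := vP j; have [j0|j0] := posnP j.
    by case/eqP: vj0; rewrite vj big1// => i; rewrite j0.
  have jT : (j : nat) \in ThetaM d by apply: mem_set; rewrite /ThetaM/= j0 ltn_ord.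
  have /negP := vjn (exist _ (j : nat) jT) (leqnn _); apply; rewrite vj.
  apply: memv_suml => i ij; apply: memvZ; have [_ + _] := vP i; exact.
exists M, Mu; apply/esym/flag_eq_sub => r _ /mem_flag_of[c cr ->].
rewrite ME; apply: memv_suml => j _; have [rj|jr] := leqP (val r) j.
  by rewrite cr// scale0r mem0v.
by apply: memvZ; have [_ + _] := vP j; exact.
Qed.

End Flags.

(** * The attractor of a regular element *)

Section Attractor.
Context {R : realType} {d : nat}.

Lemma polyfun_mxline m n (A B : 'M[R]_(m, n)) i j :
  polyfun (fun t => (A + t *: B) i j).
Proof. by under eq_fun do rewrite mxE mxE; exact: polyfun_line. Qed.

(** Its determinant is the leading principal minor of order [j]; padding with the identity keeps the
    size [d] for every [j]. *)
Definition leading (j : nat) (N : 'M[R]_d) : 'M[R]_d :=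
  \matrix_(a, b) (if (a < j)%N && (b < j)%N then N a b else (a == b)%:R).

Lemma leading1 j : leading j 1%:M = 1%:M.
Proof. by apply/matrixP => a b; rewrite !mxE; case: ifP; rewrite ?mxE. Qed.

Lemma gauss_column (j : 'I_d) (N : 'M[R]_d) : \det (leading j N) != 0 ->
  exists r : 'cV[R]_d, (forall i : 'I_d, (j <= i)%N -> r i 0 = 0) /\
    (forall i : 'I_d, (i < j)%N -> (N *m r) i 0 = - N i j).
Proof.
move=> Nj; pose b : 'cV[R]_d := \col_i (if (i < j)%N then - N i j else 0).
have [r rE] : exists r, leading j N *m r = b.
  by exists (invmx (leading j N) *m b); rewrite mulKVmx// unitmxE unitfE.
have r0 (i : 'I_d) : (j <= i)%N -> r i 0 = 0.
  move=> ji; have /colP/(_ i) := rE; rewrite [in RHS]mxE ltnNge ji /= => <-.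
  rewrite mxE (bigD1 i)//= big1 ?addr0 => [|m mi]; rewrite [leading _ _ _ _]mxE ltnNge ji/=.
    by rewrite eqxx mul1r.
  by rewrite eq_sym (negPf mi) mul0r.
exists r; split => // i ij; have /colP/(_ i) := rE; rewrite [in RHS]mxE ij => <-.
rewrite !mxE; apply: eq_bigr => m _; have [jm|mj] := leqP j m.
  by rewrite r0// !mulr0.
by rewrite [leading _ _ _ _]mxE ij mj.
Qed.

(* The LU factorisation, in the form [N Y = L]. *)
Lemma gauss_elimination (N : 'M[R]_d) :
  (forall j : 'I_d, \det (leading j N) != 0) ->
  exists Y : 'M[R]_d, [/\ is_trig_mx Y^T, forall i, Y i i = 1 &
    is_trig_mx (N *m Y)].
Proof.
move=> Nj; have [r rP] := choice (fun j => gauss_column (Nj j)).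
exists (\matrix_(i, j) ((i == j)%:R + r j i 0)); split.
- apply/is_trig_mxP => i j ij; rewrite !mxE (rP i).1 ?(ltnW ij)// addr0.
  by rewrite -val_eqE /= gtn_eqF.
- by move=> i; rewrite !mxE eqxx (rP i).1// addr0.
- apply/is_trig_mxP => i j ij; have := (rP j).2 i ij; rewrite !mxE => h.
  under eq_bigr do rewrite mxE mulrDr.
  rewrite big_split /= h (bigD1 j)//= eqxx mulr1 big1 ?addr0 ?subrr// => m mj.
  by rewrite (negPf mj) mulr0.
Qed.

Context (S : set (SL R d)) (g : 'M[R]_d) (e : R).
Context (SS : semigroup S) (e0 : 0 < e).
Context (gS : forall A, mxclose e A g -> cone_over S A).

(** On the segment from [g] to [B], small parameters stay in the ball around [g], while [t = 1]
    gives [B], where the condition is easy to check. *)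
Lemma cone_over_generic (f : R -> R) (B : 'M[R]_d) :
  polyfun f -> f 1 != 0 ->
  exists2 t, f t != 0 & cone_over S (g + t *: (B - g)).
Proof.
move=> fp f1; have [c c0 hc] := mxclose_line g (B - g) e0.
have [t tc ft] := polyfun_small_neq0 fp f1 c0.
by exists t => //; apply: gS; exact: hc.
Qed.

Context (Q : 'M[R]_d) (Qu : Q \in unitmx) (l : 'I_d -> R).
Context (l0 : forall i, 0 < l i).
Context (l_lt : forall i j : 'I_d, (i < j)%N -> l j < l i).
Context (hT : cone_over S (Q *m diag_mx (\row_i l i) *m invmx Q)).

(** The exponent is positive because [S] may lack the identity. *)
Lemma cone_over_power n : (0 < n)%N ->
  cone_over S (Q *m diag_mx (\row_i (l i ^+ n)) *m invmx Q).
Proof.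
case: n => // n _; elim: n => [|n IH].
  rewrite (_ : \row_i (l i ^+ 1) = \row_i l i)//.
have -> : Q *m diag_mx (\row_i (l i ^+ n.+2)) *m invmx Q =
    (Q *m diag_mx (\row_i l i) *m invmx Q) *m
    (Q *m diag_mx (\row_i (l i ^+ n.+1)) *m invmx Q).
  rewrite !mulmxA mulmxKV// -[Q *m _ *m diag_mx _]mulmxA mulmx_diag.
  by congr (_ *m diag_mx _ *m _); apply/rowP => i; rewrite !mxE exprS.
exact: cone_overM.
Qed.

Lemma cvg_ratio (i j : 'I_d) : (j < i)%N -> (fun n => (l i / l j) ^+ n) @ \oo --> (0 : R).
Proof.
move=> ji; apply: cvg_expr; rewrite ger0_norm ?divr_ge0 ?ltW//.
by rewrite ltr_pdivrMr// mul1r l_lt.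
Qed.

Lemma flag_act_SL1 (Theta : set nat) (s : SL R d) (V : flag R d Theta) :
  val s = 1%:M -> flag_act s V = V.
Proof.
move=> s1; apply: flag_eq_sub => r _ /mem_flag_act[v vV ->].
by rewrite s1 mul1mx.
Qed.

Lemma low_diag r (a : 'rV[R]_d) c : low r c -> low r (diag_mx a *m c).
Proof. by move=> cr i ri; rewrite mul_diag_mx mxE cr// mulr0. Qed.

Lemma low_upper r (Y : 'M[R]_d) c : is_trig_mx Y^T -> low r c -> low r (Y *m c).
Proof.
move=> /is_trig_mxP Y0 cr i ri; rewrite mxE big1// => j _.
have [rj|jr] := leqP r j; first by rewrite cr// mulr0.
by have := Y0 j i (leq_trans jr ri); rewrite mxE => ->; rewrite mul0r.
Qed.

(** Write [s0 M = Q L Y^-1] with [L] lower and [Y] upper triangular. Upper triangular factors on the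
    right do not change the flag of a matrix, so [h^n] applied to [s0 V] is the flag of [Q K n],
    where [K n] tends to the identity. *)
Lemma attractor_flag (V : flag R d (ThetaM d)) :
  closure [set flag_act s V | s in S] (flag_of Qu).
Proof.
have [M [Mu ->]] := flag_basis V.
pose N t := invmx Q *m (g + t *: (Q *m invmx M - g)) *m M.
have [t] : exists2 t, \prod_(j < d) \det (leading j (N t)) != 0 &
    cone_over S (g + t *: (Q *m invmx M - g)).
  apply: cone_over_generic => //.
    apply: polyfun_prod => j; apply: polyfun_det => a b.
    under eq_fun do rewrite [leading _ _ _ _]mxE.
    case: ((a < j)%N && (b < j)%N); last exact: polyfun_cst.
    by apply: polyfun_mulmx => a' b'; exact: polyfun_mxline.
  apply/prodf_neq0 => j _.
  (* At [t = 1] the matrix [N t] is the identity. *)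
  rewrite /N scale1r addrC subrK mulmxA mulVmx// mul1mx mulVmx//.
  by rewrite leading1 det1 oner_eq0.
set s0 := g + _ => Nt s0S.
have s0u := cone_over_unit s0S.
have {}Nt (j : 'I_d) : \det (leading j (N t)) != 0.
  by apply: contraNneq Nt => Nj; rewrite (bigD1 j)//= Nj mul0r.
have [Y [Yt Y1 Lt]] := gauss_elimination Nt.
have [L LE] : exists L, N t *m Y = L by exists (N t *m Y).
rewrite LE in Lt.
have L0 i : L i i != 0.
  have : \det L != 0.
    rewrite -LE -unitfE -unitmxE !unitmx_mul unitmx_inv Qu s0u Mu /=.
    rewrite -unitmx_tr unitmxE det_trig// big1 ?unitr1// => j _.
    by rewrite mxE Y1.
  by rewrite det_trig//; apply: contraNneq => Li; rewrite (bigD1 i)//= Li mul0r.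
(* [L] conjugated by the powers of the eigenvalues and normalised to a unit diagonal: entries below
   the diagonal decay like [(l i / l j) ^+ n]. *)
pose K n := diag_mx (\row_i (l i ^+ n)) *m L *m diag_mx (\row_i (l i ^+ n * L i i)^-1).
have ln0 i : l i != 0 by rewrite gt_eqF.
have KE n i j : K n i j = (l i / l j) ^+ n * (L i j / L j j).
  rewrite /K mul_mx_diag mul_diag_mx !mxE expr_div_n; field.
  by rewrite L0 expf_neq0.
(* Determinant one puts this matrix in [SL R d], so that openness of [V0] can be used through the
   orbit map of the limit flag. *)
have Kdet n : \det (Q *m K n *m invmx Q) = 1.
  rewrite [LHS]det_mulmx det_mulmx mulrAC -det_mulmx mulmxV// det1 mul1r.
  rewrite det_trig ?big1// => [i _|].
    by rewrite KE (divff (L0 i)) (divff (ln0 i)) expr1n mulr1.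
  apply/is_trig_mxP => i j ij; move/is_trig_mxP : Lt => /(_ _ _ ij) Lij.
  by rewrite KE Lij mul0r mulr0.
have Kcvg : (fun n => Q *m K n *m invmx Q) @ \oo --> (1%:M : 'M[R]_d).
  suff KQ : K @ \oo --> (1%:M : 'M[R]_d).
    have cQ (A : 'M[R]_d) : (fun=> A) @ \oo --> A by exact: cvg_cst.
    have := cvg_mulmx (cvg_mulmx (cQ Q) KQ) (cQ (invmx Q)).
    by rewrite mulmx1 mulmxV //; apply; exact: eventually_filter.
  apply: cvg_mx => i j; under eq_fun do rewrite KE.
  rewrite mxE; have [ij|ji|/val_inj ij] := ltngtP i j.
  - have -> : L i j = 0 by move/is_trig_mxP : Lt; exact.
    under eq_fun do rewrite mul0r mulr0.
    by rewrite -val_eqE /= ltn_eqF//; exact: cvg_cst.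
  - rewrite (_ : (i == j)%:R = 0 * (L i j / L j j)); last first.
      by rewrite -val_eqE /= gtn_eqF// mul0r.
    by apply: cvgM; [exact: cvg_ratio|exact: cvg_cst].
  - rewrite ij; under eq_fun do rewrite (divff (L0 j)) (divff (ln0 j)) expr1n mulr1.
    by rewrite eqxx; exact: cvg_cst.
move=> B; rewrite nbhsE => -[V0 [V0o V0x] V0B].
have [U oU UE] := open_SL (V0o (flag_of Qu)).
have UP (s : SL R d) : V0 (flag_act s (flag_of Qu)) = U (val s).
  by have /(congr1 (fun P => P s)) := UE.
have U1 : U 1%:M.
  pose s1 : SL R d := exist _ 1%:M (mem_set (det1 R d)).
  by rewrite -[1%:M]/(val s1) -UP flag_act_SL1.
have [n n0 Un] : exists2 n, (0 < n)%N & U (Q *m K n *m invmx Q).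
  have /Kcvg[n _ nU] : nbhs (1%:M : 'M[R]_d) U by exact: open_nbhs_nbhs.
  by exists n.+1 => //; apply: nU; rewrite /= leqnSn.
have [c [s [c0 Ss hs]]] := cone_overM SS (cone_over_power n0) s0S.
exists (flag_act s (flag_of Mu)); split; first by exists s.
have kSL : Q *m K n *m invmx Q \in SL R d by exact: mem_set (Kdet n).
apply: V0B; pose k : SL R d := @exist _ (fun A => A \in SL R d) _ kSL.
rewrite (_ : flag_act s _ = flag_act k (flag_of Qu)); first by rewrite UP.
apply/esym/flag_eq_sub => r _ /mem_flag_act[_ /mem_flag_of[u ur ->] ->].
apply/mem_flag_act.
pose u' := diag_mx (\row_i (l i ^+ n * L i i)^-1) *m u.
exists (M *m (Y *m (c *: u'))).
  apply/mem_flag_of; exists (Y *m (c *: u')) => //; apply: low_upper => // i ri.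
  by rewrite mxE (low_diag _ ur) ?mulr0.
have -> : val s = c^-1 *: (Q *m diag_mx (\row_i (l i ^+ n)) *m invmx Q *m s0).
  by rewrite hs scalerA mulVf ?scale1r ?gt_eqF.
rewrite -!scalemxAr -scalemxAl scalerA mulfV ?scale1r ?gt_eqF//.
by rewrite /= [LHS]mulmxA mulmxKV// /K /u' -LE /N !mulmxA.
Qed.

End Attractor.

(** * Cones *)

Section Cones.
Context {R : realType} {n : nat}.
Implicit Types (L W : set 'cV[R]_n).

(** The sum is twice the midpoint. *)
Lemma coneD W x y : cone W -> W x -> W y -> W (x + y).
Proof.
move=> [_ _ cW WZ _] Wx Wy.
have h0 : (0 : R) <= 2^-1 by rewrite invr_ge0.
have h1 : 2^-1 <= (1 : R) by rewrite invf_le1// ler1n.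
have := set_mem (cW x y (Itv01 h0 h1) (mem_set Wx) (mem_set Wy)).
move=> /(WZ 2 _ (ler0n _ 2)); rewrite /conv /=.
rewrite scalerDr !scalerA /unstable.onem divff ?pnatr_eq0// !scale1r.
rewrite (_ : 2 * (1 - 2^-1) = 1 :> R) ?scale1r//; lra.
Qed.

Lemma subspace_functional L :
  L 0 -> (forall x y, L x -> L y -> L (x + y)) ->
  (forall (a : R) x, L x -> L (a *: x)) -> (exists x, ~ L x) ->
  exists2 f : 'rV[R]_n, f != 0 & forall x, L x -> f *m x = 0.
Proof.
move=> L0 LD LZ [x Lx].
(* A matrix of maximal rank with rows in [L] has [L] as its row space. *)
pose P r := `[< exists m (A : 'M[R]_(m, n)), \rank A = r /\ forall i, L (row i A)^T >].
have P0 : exists r, P r.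
  by exists 0%N; apply/asboolP; exists 0%N, 0; rewrite mxrank0; split => // -[].
have Pn r : P r -> (r <= n)%N by move=> /asboolP[m [A [<- _]]]; exact: rank_leq_col.
case: (ex_maxnP P0 Pn) => r /asboolP[m [A [rA LA]]] rmax.
have LsubA y : L y -> (y^T <= A)%MS.
  move=> Ly; apply/negPn/negP => yA.
  have : P (\rank (col_mx A y^T)).
    apply/asboolP; exists (m + 1)%N, (col_mx A y^T); split => // i.
    case: (split_ordP i) => j ->; first by rewrite rowKu.
    by rewrite rowKd (_ : row j y^T = y^T) ?trmxK//; apply/rowP => a; rewrite !mxE ord1.
  move=> /rmax; rewrite leqNgt -rA => /negP; apply; apply: rank_ltmx.
  rewrite ltmxE !col_mx_sub submx_refl /= (negPf yA) andbT.
  by have := submx_refl (col_mx A y^T); rewrite {1}col_mx_sub => /andP[].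
have AsubL y : (y^T <= A)%MS -> L y.
  move=> /submxP[D yD]; rewrite -[y]trmxK yD mulmx_sum_row.
  rewrite linear_sum /=; elim/big_ind: _ => // i _.
  by rewrite linearZ; apply: LZ; exact: LA.
have : ~~ (x^T <= A)%MS by apply/negP => /AsubL.
(* Some column of the cokernel matrix does not vanish on [x], and all of them vanish on [L]. *)
rewrite submxE => /rV0Pn[j xj]; exists (col j (cokermx A))^T.
  apply: contraNneq xj => /(congr1 trmx); rewrite trmxK trmx0 => c0.
  have : (x^T *m col j (cokermx A)) 0 0 = 0 by rewrite c0 mulmx0 mxE.
  by rewrite colE mulmxA -colE mxE => ->.
move=> y /LsubA; rewrite submxE => /eqP yA.
by rewrite -[y]trmxK -trmx_mul colE mulmxA yA mul0mx trmx0.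
Qed.

Lemma cone_line W p q : cone W -> (forall x, x != 0 -> W x -> ~ W (- x)) ->
  q != 0 -> (forall t : R, p + t *: q != 0) ->
  ~ forall t, W (p + t *: q) \/ W (- (p + t *: q)).
Proof.
move=> Wc Wpt q0 pq0 Wpq; have [Wcl _ _ WZ _] := Wc.
(* Dividing [u + (m + 1) v] by [m + 1] gives a sequence in [W] tending to [v]. *)
have limit u v : (forall t : R, W (u + t *: v)) -> W v.
  move=> Wuv; have h : (fun n => harmonic n *: u + v) @ \oo --> (0 : R) *: u + v.
    by apply: cvgD; [apply: cvgZr_tmp; exact: cvg_harmonic|exact: cvg_cst].
  suff : W ((0 : R) *: u + v) by rewrite scale0r add0r.
  apply: (closed_cvg W Wcl _ _ h); near=> m.
  rewrite (_ : _ + _ = harmonic m *: (u + m.+1%:R *: v)).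
    by apply: WZ => //; rewrite invr_ge0.
  by rewrite scalerDr scalerA mulVf ?scale1r ?pnatr_eq0.
have cl (u v : 'cV[R]_n) : closed [set t : R | W (u + t *: v)].
  apply: (@preimage_closed _ _ (fun t : R => u + t *: v)) => // t _.
  by apply: cvgD; [exact: cvg_cst|apply: cvgZr_tmp; exact: cvg_id].
pose A := [set t : R | W (p + t *: q)].
(* By pointedness the two cones cut complementary subsets of the line, both closed, so [A] is empty
   or everything. *)
have AC : A = ~` [set t : R | W (- p + t *: - q)].
  apply/seteqP; split => t /=; rewrite scalerN -opprD => Wt.
    exact: Wpt.
  by case: (Wpq t).
have [A0|/nonemptyPn A0] := pselect (A !=set0).
  have AT : A = setT.
    have /connected_intervalP : is_interval [set: R] by [].
    apply => //; first by exists A; rewrite ?setTI// AC openC; exact: cl.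
    by exists A; rewrite ?setTI//; exact: cl.
  have WA t : W (p + t *: q) by have : A t by rewrite AT.
  apply: (Wpt q q0); first exact: limit WA.
  by apply: (limit p) => t; rewrite scalerN -scaleNr.
have WA t : W (- p + t *: - q).
  have : (~` A) t by rewrite A0.
  by rewrite AC /= => /contrapT.
apply: (Wpt q q0); last exact: limit WA.
by apply: (limit (- p)) => t; have := WA (- t); rewrite scaleNr scalerN opprK.
Unshelve. all: by end_near.
Qed.

End Cones.

(** * Cones invariant under the semigroup *)

Section InvariantCones.
Context {R : realType} {d k : nat}.
Context (S : set (SL R d)) (g : 'M[R]_d) (e : R).
Context (SS : semigroup S) (e0 : 0 < e).
Context (gS : forall A, mxclose e A g -> cone_over S A).
Context (W : set (ext R k d)) (Wc : cone W).
Context (W_inv : forall s : SL R d, S s -> ext_act (val s) @` W `<=` W).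

Lemma cone_over_inv A w : cone_over S A -> W w -> W (ext_act A w).
Proof.
move=> [c [s [c0 Ss ->]]] Ww; rewrite ext_actZl; have [_ _ _ WZ _] := Wc.
by apply: WZ; rewrite ?exprn_ge0 ?ltW//; apply: (W_inv Ss); exists w.
Qed.

Lemma ext_act_generic (f : 'rV[R]_#|{: incr_map k d}|) w (P : 'M[R]_d) :
  P \in unitmx -> f != 0 -> w != 0 ->
  exists2 A, cone_over S A & (f *m ext_act (P *m A) w) 0 0 != 0.
Proof.
move=> Pu f0 w0; have [B fB] := ext_act_nondegenerate f0 w0.
have [|t ft tS] := cone_over_generic e0 gS (invmx P *m B)
  (polyfun_ext_act f w P g (invmx P *m B - g)).
  by rewrite scale1r addrC subrK mulmxA mulmxV// mul1mx.
by exists (g + t *: (invmx P *m B - g)).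
Qed.

(** A nonzero functional [f] vanishes on the proper subspace [L]; yet [L] is invariant, and a
    generic [A] gives [f (A w) != 0]. *)
Lemma invariant_cone_pointed w : w != 0 -> W w -> ~ W (- w).
Proof.
move=> w0 Ww WNw; have [_ _ _ WZ [WT _]] := Wc.
pose L := [set x | W x /\ W (- x)].
have LZ (a : R) x : L x -> L (a *: x).
  move=> [Wx WNx]; have [a0|a0] := leP 0 a.
    by split; rewrite -?scalerN; exact: WZ.
  have Na0 : 0 <= - a by rewrite oppr_ge0 ltW.
  by split; [rewrite -[a]opprK scaleNr -scalerN|rewrite -scaleNr]; exact: WZ.
have [f f0 fL] : exists2 f : 'rV[R]_#|{: incr_map k d}|, f != 0 &
    forall x, L x -> f *m x = 0.
  apply: subspace_functional => //.
  - by rewrite -(scale0r w); exact: LZ.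
  - by move=> x y [Wx WNx] [Wy WNy]; split; rewrite ?opprD; exact: coneD.
  - apply: contrapT => nex; apply: WT; apply/seteqP; split => // x _.
    by apply: contrapT => Wx; apply: nex; exists x => -[].
have [A AS] := ext_act_generic (unitmx1 R d) f0 w0.
rewrite mul1mx fL ?mxE ?eqxx//; split; first exact: cone_over_inv.
by rewrite -scaleN1r -ext_actZ scaleN1r; exact: cone_over_inv.
Qed.

(** A subspace determines its wedge only up to a scalar of either sign, hence the union of [W] and
    its opposite. *)
Definition in_double_cone w := W w \/ W (- w).

Lemma in_double_coneZ (a : R) w : in_double_cone w -> in_double_cone (a *: w).
Proof.
have [_ _ _ WZ _] := Wc.
have [a0|a0] := leP 0 a => -[Ww|Ww].
- by left; exact: WZ.
- by right; rewrite -scalerN; exact: WZ.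
- by right; rewrite -scaleNr; apply: WZ; rewrite ?oppr_ge0 ?ltW.
- by left; rewrite -[a]opprK scaleNr -scalerN; apply: WZ; rewrite ?oppr_ge0 ?ltW.
Qed.

Lemma closed_double_cone : closed in_double_cone.
Proof.
have [Wcl _ _ _ _] := Wc.
suff cN : closed [set w | W (- w)] by exact: closedU Wcl cN.
apply: (@preimage_closed _ _ (fun w : ext R k d => - w)) => // x _.
exact: oppr_continuous.
Qed.

Context (Q : 'M[R]_d) (Qu : Q \in unitmx) (l : 'I_d -> R).
Context (l0 : forall i, 0 < l i).
Context (l_lt : forall i j : 'I_d, (i < j)%N -> l j < l i).
Context (hT : cone_over S (Q *m diag_mx (\row_i l i) *m invmx Q)).
Context (kd : (k <= d)%N).

(** Power iteration: [A] makes the dominant coordinate of [v = Q^-1 A w] nonzero, and [h^n A w],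
    divided by the n-th power of the dominant eigenvalue, tends to that coordinate times the
    dominant eigenvector. The sign of the coordinate is unknown. *)
Lemma attractor_wedge : in_double_cone (wedge (Q *m pid_mx k)).
Proof.
have [Wcl _ _ WZ [_ W0]] := Wc.
have [w Ww w0] : exists2 w, W w & w != 0.
  apply: contrapT => nex; apply: W0; apply/seteqP; split => [w Ww|w ->] /=.
    by apply: contrapT => /eqP w0; apply: nex; exists w.
  by have [_ [x Wx] _ _ _] := Wc; rewrite -(scale0r x); exact: WZ.
have [a0 [pidE mu_lt]] := wedge_pid_mx (R := R) kd.
pose mu (a : 'I_#|{: incr_map k d}|) := \prod_(i < k) l (val (enum_val a) i).
have mu0 a : 0 < mu a by apply: prodr_gt0.
have f0 : delta_mx 0 a0 != 0 :> 'rV[R]_#|{: incr_map k d}|.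
  by apply/rV0Pn; exists a0; rewrite mxE !eqxx oner_eq0.
have Qu' : invmx Q \in unitmx by rewrite unitmx_inv.
have [A AS] := ext_act_generic Qu' f0 w0.
rewrite -rowE mxE; set v := ext_act _ w => va0.
pose z n := \sum_a ((mu a / mu a0) ^+ n) *: (v a 0 *: ext_act Q (delta_mx a 0)).
have Wz n : (0 < n)%N -> W (z n).
  move=> n0; have := cone_over_inv (cone_overM SS (cone_over_power SS Qu hT n0) AS) Ww.
  rewrite -[_ *m A]mulmxA ext_actM ext_actM -/v => /(WZ (mu a0 ^+ n)^-1).
  rewrite invr_ge0 exprn_ge0 ?ltW// => /(_ isT).
  rewrite -ext_actZ [X in ext_act Q X]cV_sum_delta ext_act_sum.
  congr W; apply: eq_bigr => a _; rewrite ext_actZ scalerA; congr (_ *: _).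
  rewrite mxE ext_act_diag prodrXl expr_div_n; ring.
have zcvg : z @ \oo --> \sum_a (a == a0)%:R *: (v a 0 *: ext_act Q (delta_mx a 0)).
  apply: cvg_sumr => a _; apply: cvgZr_tmp; have [->|ne] := eqVneq a a0.
    rewrite divff ?gt_eqF// (_ : GRing.exp 1 = fun=> 1); first exact: cvg_cst.
    by apply/funext => n; rewrite expr1n.
  apply: cvg_expr; rewrite ger0_norm ?divr_ge0 ?ltW//.
  by rewrite ltr_pdivrMr// mul1r; exact: mu_lt.
have : W (v a0 0 *: wedge (Q *m pid_mx k)).
  rewrite -ext_act_wedge pidE.
  have -> : v a0 0 *: ext_act Q (delta_mx a0 0) =
      \sum_a (a == a0)%:R *: (v a 0 *: ext_act Q (delta_mx a 0)).
    rewrite (bigD1 a0)//= eqxx scale1r big1 ?addr0// => a /negPf ->.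
    by rewrite scale0r.
  apply: (closed_cvg W Wcl _ _ zcvg); near=> n; apply: Wz; near: n.
  exact: nbhs_infty_gt.
move=> Wv; rewrite -[wedge _](scalerK va0).
by apply: in_double_coneZ; left.
Unshelve. all: by end_near.
Qed.

Lemma orbit_closure_double_cone (kT : ThetaM d) (V : flag R d (ThetaM d))
    (U : 'M[R]_(d, k)) : val kT = k ->
  closure [set flag_act s (flag_of Qu) | s in S] V ->
  (forall j, col j U \in V kT) -> in_double_cone (wedge U).
Proof.
move=> kTk clV UV; apply: contrapT => WU.
(* The flags violating the conclusion form an open set; if it contained [V], it would meet the orbit
   of the attracting flag, where the conclusion holds by invariance. *)
pose N := [set V : flag R d (ThetaM d) |
  exists U : 'M[R]_(d, k), (forall j, col j U \in V kT) /\ ~ in_double_cone (wedge U)].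
have oN : open N.
  rewrite flag_openE => V'.
  rewrite (_ : [set _ | _] = \bigcup_(X in [set X : 'M[R]_(d, k) |
      forall j, col j X \in V' kT])
      [set s : SL R d | ~ in_double_cone (wedge (val s *m X))]); last first.
    apply/seteqP; split => s /=.
      move=> [X [XV XW]]; exists (invmx (val s) *m X).
        move=> j /=; have /mem_flag_act[v vV Xj] := XV j.
        by rewrite colE -mulmxA -colE Xj mulKmx// SL_unit.
      by rewrite /= mulKVmx// SL_unit.
    move=> [X XV XW]; exists (val s *m X); split => // j.
    by apply/mem_flag_act; exists (col j X) => //; rewrite !colE mulmxA.
  apply: bigcup_open => X _.
  apply: (@open_val_SL _ _ (fun A => ~ in_double_cone (wedge (A *m X)))).
  apply: (@open_comp _ _ (fun A : 'M[R]_d => wedge (A *m X)) (~` in_double_cone)).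
    move=> A _; apply: (@cvg_wedge _ _ (nbhs A) _ _ _ (fun B => B *m X) (A *m X)).
    exact: (@cvg_mulmx _ _ (nbhs A) _ _ _ _ id (fun=> X) A X cvg_id (cvg_cst _)).
  by rewrite openC; exact: closed_double_cone.
have [|_ [[s Ss <-] [X [XV]]]] := clV N.
  by apply: open_nbhs_nbhs; split => //; exists U.
apply; have sS : cone_over S (val s).
  by exists 1, s; split => //; rewrite scale1r.
(* The columns of [X] lie in the image under [s] of the first [k] columns of [Q], so [wedge X] is a
   multiple of the image of the dominant eigenvector. *)
pose Y := invmx Q *m (invmx (val s) *m X).
have XE : X = val s *m (Q *m Y) by rewrite !mulKVmx// SL_unit.
have Ylow (i : 'I_d) j : (k <= i)%N -> Y i j = 0.
  move=> ki; have /mem_flag_act[v /mem_flag_of[c cr ->] Xj] := XV j.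
  have : col j Y = c by rewrite /Y !colE -!mulmxA -!colE Xj !mulKmx// SL_unit.
  by move=> /colP/(_ i); rewrite mxE => ->; apply: cr; rewrite kTk.
rewrite XE -ext_act_wedge -(mulmx_pid_low Ylow) mulmxA wedge_mulmx.
have [|Wx] := in_double_coneZ (\det ((pid_mx k : 'M[R]_(k, d)) *m Y)) attractor_wedge.
  by move=> Wx; left; exact: cone_over_inv.
by right; rewrite -scaleN1r -ext_actZ scaleN1r; exact: cone_over_inv.
Qed.

End InvariantCones.

(** * The invariant control set and the conclusion *)

Lemma attractor_control_set (R : realType) (d : nat) (S : set (SL R d))
    (x : flag R d (ThetaM d)) (C : set (flag R d (ThetaM d))) :
  semigroup S -> invariant_control_set S C ->
  (forall V, closure [set flag_act s V | s in S] x) ->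
  C = closure [set flag_act s x | s in S].
Proof.
move=> SS [CP Cmax] xV.
have [[V CV]|C0] := pselect (C !=set0).
  by have := xV V; rewrite (CP V CV) => /CP.
(* If [C] is empty, maximality still applies: the orbit closure of [x] has the defining property, as
   [x] lies in the closure of every orbit. *)
apply/esym/Cmax => [V xclV|V CV]; last by case: C0; exists V.
apply/seteqP; split; exact: closure_orbit_sub.
Qed.

Theorem theorem9 (R : realType) (d : nat) (d_ge2 : (2 <= d)%N)
  (S : set (SL R d)) (S_semigroup : semigroup S) (S_connected : connected S)
  (S_int : S° !=set0)
  (Theta : set nat) (Theta_flag_type : is_flag_type S Theta)
  (k : nat) (k_ThetaM : k \in ThetaM d)
  (W : set (ext R k d)) (W_neq0 : [set 0] <> W) (W_cone : cone W)
  (W_inv : forall g : SL R d, S g -> ext_act (val g) @` W `<=` W) :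
  k \in Theta.
Proof.
have [[sub [C [CT [IC _ CE]]]] _] := Theta_flag_type.
have /andP[k0 kd] := set_mem k_ThetaM.
have [g [e [e0 gS]]] := cone_over_ball (ltnW d_ge2) S_int.
have [Q [l [Qu l0 l_lt hT]]] :=
  semigroup_regular_element (fun A B => @cone_overM _ _ S A B S_semigroup) e0 gS.
pose x := flag_of Qu.
have xV V : closure [set flag_act s V | s in S] x.
  exact: (attractor_flag S_semigroup e0 gS l0 l_lt hT).
have CX := attractor_control_set S_semigroup IC xV.
apply: contrapT => /negP kT.
pose kt : ThetaM d := exist _ k k_ThetaM.
have kn : (k.-1 < d)%N by rewrite (leq_ltn_trans (leq_pred _) kd).
pose i1 : 'I_d := Ordinal kd; pose i0 : 'I_d := Ordinal kn.
have kk : (k.-1 < k)%N by rewrite prednK.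
pose j0 : 'I_k := Ordinal kk.
(* [Q *m X t] has [Q e_(k-1) + t Q e_k] as its column [k - 1] and agrees with [Q] elsewhere, so only
   the member of dimension [k] of the flag can change. *)
pose X (t : R) : 'M[R]_d := 1%:M + t *: delta_mx i1 i0.
have Xtrig t : is_trig_mx (X t).
  apply/is_trig_mxP => i j ij; rewrite !mxE -val_eqE /= ltn_eqF// add0r.
  case: eqP => [ii|_]; last by rewrite mulr0.
  case: eqP => [jj|_]; last by rewrite mulr0.
  by move: ij; rewrite ii jj /= ltnNge leq_pred.
have Xu t : Q *m X t \in unitmx.
  rewrite unitmx_mul Qu unitmxE det_trig// big1 ?unitr1// => i _.
  rewrite !mxE eqxx; case: eqP => [->|_]; last by rewrite mulr0 addr0.
  by rewrite -val_eqE /= gtn_eqF ?mulr0 ?addr0.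
have CXt t : C (flag_of (Xu t)).
  have Cx : C x by rewrite CX; exact: xV.
  rewrite -CE /=; rewrite -CE /= in Cx.
  suff -> : flag_proj sub (flag_of (Xu t)) = flag_proj sub x by [].
  apply: flag_eq_sub => r v.
  have projE V : flag_proj sub V r = V (index_incl sub r) by [].
  rewrite !projE => /mem_flag_of[c cr ->].
  apply/mem_flag_of; exists (X t *m c); last by rewrite mulmxA.
  (* The only new coordinate is [t c_(k-1)] in row [k]. For [r <= k] it vanishes, because [r] lies
     in [Theta] and [k] does not, so [r <= k - 1]. *)
  move=> i ri; rewrite mulmxDl mul1mx !mxE cr// add0r big1// => m _; rewrite !mxE.
  have [ii|_] /= := eqVneq i i1; last by rewrite mulr0 mul0r.
  have [mm|_] := eqVneq m i0; last by rewrite mulr0 mul0r.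
  rewrite cr ?mulr0// mm /= -ltnS prednK// ltn_neqAle; move: ri; rewrite ii /= => ->.
  rewrite andbT; apply: contraNneq kT => rk.
  by rewrite -rk; exact: (valP r).
pose P : 'M[R]_(d, k) := pid_mx k.
(* Selects [e_0, ..., e_(k-2), e_k], so that [wedge (Q *m P')] is the vector [q] of the overview. *)
pose f (b : 'I_k) := if b == j0 then i1 else widen_ord (ltnW kd) b.
have f_inj : injective f.
  move=> a b; rewrite /f; case: (eqVneq a j0) => [->|_]; case: (eqVneq b j0) => [->|_] //.
  - by move=> /(congr1 val) /= bk; have := ltn_ord b; rewrite -bk ltnn.
  - by move=> /(congr1 val) /= ak; have := ltn_ord a; rewrite ak ltnn.
  - by move=> /(congr1 val) /= ab; exact: val_inj.
pose P' : 'M[R]_(d, k) := colsub f 1%:M.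
have PE t : wedge (Q *m X t *m P) = wedge (Q *m P) + t *: wedge (Q *m P').
  rewrite -mulmxA -!(ext_act_wedge Q) -ext_actZ -ext_actD; congr ext_act.
  have XP i b : (X t *m P) i b = P i b + t * ((i == i1) && (b == j0))%:R.
    rewrite mulmxDl mul1mx -scalemxAl !mxE; congr (_ + _ * _).
    rewrite (bigD1 i0)//= big1 ?addr0 => [|m mi]; rewrite !mxE.
      by rewrite eqxx andbT -natrM mulnb /= kk andbT -[b == j0]val_eqE [val b == _]eq_sym.
    by rewrite (negPf mi) andbF mul0r.
  apply: (@wedge_multilinear _ _ _ j0) => [i|i b bj].
    by rewrite XP !mxE /f !eqxx andbT.
  rewrite XP (negPf bj) andbF mulr0 addr0; split => //.
  rewrite !mxE /f (negPf bj) -val_eqE /=; congr (_%:R).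
  by case: eqP => //= ->; rewrite ltn_ord.
have Wpt w : w != 0 -> W w -> ~ W (- w).
  exact: (invariant_cone_pointed e0 gS W_cone W_inv).
apply: (@cone_line _ _ W (wedge (Q *m P)) (wedge (Q *m P')) W_cone Wpt) => [|t|t].
(* An explicit left inverse shows that the columns are independent. *)
- apply: (@wedge_neq0 _ _ _ _ (rowsub f 1%:M *m invmx Q)).
  rewrite mulmxA mulmxKV// mul_rowsub_mx mul1mx.
  by apply/matrixP => a b; rewrite !mxE (inj_eq f_inj).
- rewrite -PE; apply: (@wedge_neq0 _ _ _ _ ((pid_mx k : 'M[R]_(k, d)) *m invmx (Q *m X t))).
  rewrite mulmxA mulmxKV// mul_pid_mx minnn (minn_idPr (ltnW kd)).
  by rewrite pid_mx_1.
- rewrite -PE; have := CXt t; rewrite CX => clX.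
  apply: (orbit_closure_double_cone S_semigroup e0 gS W_cone W_inv l0 l_lt hT
    (ltnW kd) (kT := kt) _ clX) => // j.
  apply/mem_flag_of; exists (col j P); last by rewrite !colE mulmxA.
  by move=> i ki; rewrite !mxE ltnNge ki andbF.
Qed.
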